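(* Let $V$ be a strongly finitely generated vertex operator algebra over a field $\mathbb{F}$ with $\mathrm{char}(\mathbb{F})\neq2$, and let $M=\bigoplus_{n\in\mathbb{Z}_+}M(n)$ be an irreducible admissible $V$-module (graded so that $M(0)\neq0$). Then the following conditions are equivalent: (1) $M$ is an absolutely irreducible $V$-module. (2) $M(0)$ is an absolutely simple $A(V)$-module. (3) $\mathrm{End}_V(M)=\mathrm{End}_{A(V)}(M(0))=\mathbb{F}$ (that is, both endomorphism algebras consist only of the scalars).
   Context: $\mathbb{Z}_+$ denotes the set of non-negative integers. A vertex algebra over $\mathbb{F}$ is an $\mathbb{F}$-vector space $V$ with a linear map $Y(-,z):V\to(\mathrm{End}\,V)[[z,z^{-1}]]$, $v\mapsto Y(v,z)=\sum_{n\in\mathbb{Z}}v_nz^{-n-1}$, and a vector $\mathbf{1}\in V$ such that for all $u,v\in V$: $u_nv=0$ for $n$ sufficiently large; $Y(\mathbf{1},z)=\mathrm{Id}_V$; $Y(v,z)\mathbf{1}\in V[[z]]$ with $\lim_{z\to0}Y(v,z)\mathbf{1}=v$; and the Jacobi identity $$z_0^{-1}\delta\left(\tfrac{z_1-z_2}{z_0}\right)Y(u,z_1)Y(v,z_2)-z_0^{-1}\delta\left(\tfrac{z_2-z_1}{-z_0}\right)Y(v,z_2)Y(u,z_1)=z_2^{-1}\delta\left(\tfrac{z_1-z_0}{z_2}\right)Y(Y(u,z_0)v,z_2)$$ holds, where $\delta(z)=\sum_{n\in\mathbb{Z}}z^n$ and powers of binomials are expanded in non-negative powers of the second variable. A vertex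 operator algebra over $\mathbb{F}$ is a vertex algebra with a grading $V=\bigoplus_{n\in\mathbb{Z}_+}V_n$, $\dim V_n<\infty$, $\mathbf{1}\in V_0$, and a vector $\omega\in V_2$, such that $u_nv\in V_{s+t-n-1}$ for $u\in V_s$, $v\in V_t$, $n\in\mathbb{Z}$ (with $V_k=0$ for $k<0$), and, writing $L(m)=\omega_{m+1}$, $[L(m),L(n)]=(m-n)L(m+n)+\frac12\binom{m+1}{3}\delta_{m+n,0}c$ for some $c\in\mathbb{F}$, $\frac{d}{dz}Y(v,z)=Y(L(-1)v,z)$, and $L(0)|_{V_n}=n$. For $u\in V_n$ write $\mathrm{wt}\,u=n$ (an integer). $V$ is strongly finitely generated if there is a finite-dimensional subspace $U\subset V$ such that $V$ is spanned by the elements $u^1_{-n_1}\cdots u^r_{-n_r}\mathbf{1}$ with $r\geq0$, $u^i\in U$, $n_i\geq1$. A weak $V$-module is a vector space $M$ with a linear map $Y_M(-,z):V\to(\mathrm{End}\,M)[[z,z^{-1}]]$, $v\mapsto\sum_nv_nz^{-n-1}$, such that $u_lw=0$ for $l\gg0$ ($u\in V$, $w\in M$), $Y_M(\mathbf{1},z)=\mathrm{Id}_M$, and the Jacobi identity holds with $Y_M(u,z_1)$, $Y_M(v,z_2)$, $Y_M(Y(u,z_0)v,z_2)$ in place of the corresponding operators. An admissible $V$-module is a weak $V$-module with a grading $M=\bigoplus_{n\in\mathbb{Z}_+}M(n)$ such that $u_nM(t)\subset M(s+t-n-1)$ for $u\in V_s$, $n\in\mathbb{Z}$, $t\in\mathbb{Z}_+$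 (with $M(k)=0$ for $k<0$). It is irreducible if it is nonzero and has no admissible (graded) submodules other than $0$ and itself. $\mathrm{End}_V(M)$ is the $\mathbb{F}$-algebra of linear maps $M\to M$ commuting with all $v_n$ ($v\in V$, $n\in\mathbb{Z}$). Zhu's algebra: $A(V)=V/O(V)$, where $O(V)$ is spanned by $\mathrm{Res}_zY(u,z)v\frac{(1+z)^{\mathrm{wt}\,u+s}}{z^{2+t}}$ for homogeneous $u\in V$, $v\in V$, $s,t\in\mathbb{Z}_+$, $t\geq s$, together with $L(-1)u+L(0)u$ for $u\in V$. It is an associative algebra with unit $\mathbf{1}+O(V)$ under the product induced by $u*v=\mathrm{Res}_zY(u,z)v\frac{(1+z)^{\mathrm{wt}\,u}}{z}$ ($u$ homogeneous, extended bilinearly). For an admissible $V$-module $M$, $M(0)$ is an $A(V)$-module with $[u]=u+O(V)$ acting as $u_{\mathrm{wt}\,u-1}$ for homogeneous $u$. For a field extension $\mathbb{K}/\mathbb{F}$, $V^{\mathbb{K}}=\mathbb{K}\otimes_{\mathbb{F}}V$ is the vertex operator algebra over $\mathbb{K}$ with vacuum $1\otimes\mathbf{1}$, conformal vector $1\otimes\omega$, and $Y^{\mathbb{K}}(\lambda\otimes a,z)(\mu\otimes b)=\lambda\mu\otimes Y(a,z)b$; $M^{\mathbb{K}}=\mathbb{K}\otimes_{\mathbb{F}}M=\bigoplus_n\mathbb{K}\otimes_{\mathbb{F}}M(n)$ is the admissible $V^{\mathbb{K}}$-module with $Y_{M^{\mathbb{K}}}(\lambda\otimes a,z)(\mu\otimes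 w)=\lambda\mu\otimes Y_M(a,z)w$. An irreducible admissible $V$-module $M$ is absolutely irreducible if $M^{\mathbb{K}}$ is an irreducible admissible $V^{\mathbb{K}}$-module for every field extension $\mathbb{K}/\mathbb{F}$. A simple module $S$ over an associative $\mathbb{F}$-algebra $A$ is absolutely simple if $\mathbb{K}\otimes_{\mathbb{F}}S$ is a simple $\mathbb{K}\otimes_{\mathbb{F}}A$-module for every field extension $\mathbb{K}/\mathbb{F}$. *)

(* Defs.v *)
From HB Require Import structures.
From mathcomp Require Import all_boot all_algebra.
From mathcomp Require Import boolp zify.

Set Implicit Arguments.
Unset Strict Implicit.
Unset Printing Implicit Defensive.

Import GRing.Theory.
Local Open Scope ring_scope.
Local Open Scope quotient_scope.

Definition eventually (P : nat -> Prop) : Prop :=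
  exists N0 : nat, forall N : nat, (N0 <= N)%N -> P N.

Section LinearAlgebra.
Variables (F : fieldType) (V : lmodType F).

Definition is_subspace (U : V -> Prop) : Prop :=
  U 0 /\ forall (a : F) (x y : V), U x -> U y -> U (a *: x + y).

Inductive span (P : V -> Prop) : V -> Prop :=
| span_zero : span P 0
| span_step (a : F) (x y : V) : P x -> span P y -> span P (a *: x + y).

Definition finite_dim (U : V -> Prop) : Prop :=
  exists (d : nat) (b : 'I_d -> V), (forall i, U (b i)) /\
    forall x, U x -> exists c : 'I_d -> F, x = \sum_(i < d) c i *: b i.

Record is_grading (gr : nat -> V -> Prop) : Prop := IsGrading {
  grading_sub : forall n, is_subspace (gr n);
  grading_sum : forall v, exists (N : nat) (x : nat -> V),
    (forall i, gr i (x i)) /\ v = \sum_(i < N) x i;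
  grading_free : forall (N : nat) (x : nat -> V),
    (forall i, gr i (x i)) -> \sum_(i < N) x i = 0 ->
    forall i, (i < N)%N -> x i = 0 }.

Definition grz (gr : nat -> V -> Prop) (n : int) (v : V) : Prop :=
  match n with Posz n => gr n v | Negz _ => v = 0 end.

Lemma is_subspaceD (U : V -> Prop) : is_subspace U ->
  forall x y, U x -> U y -> U (x + y).
Proof. by case=> _ H x y Ux Uy; have := H 1 _ _ Ux Uy; rewrite scale1r. Qed.

Lemma is_subspaceZ (U : V -> Prop) : is_subspace U ->
  forall a x, U x -> U (a *: x).
Proof. by case=> U0 H a x Ux; have := H a _ _ Ux U0; rewrite addr0. Qed.

Lemma is_subspaceN (U : V -> Prop) : is_subspace U ->
  forall x, U x -> U (- x).
Proof. by move=> UP x /(is_subspaceZ UP (-1)); rewrite scaleN1r. Qed.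

Lemma is_subspaceB (U : V -> Prop) : is_subspace U ->
  forall x y, U x -> U y -> U (x - y).
Proof. by move=> UP x y Ux Uy; apply: is_subspaceD => //; apply: is_subspaceN. Qed.

Lemma is_subspaceMn (U : V -> Prop) : is_subspace U ->
  forall x n, U x -> U (x *+ n).
Proof. by move=> UP x n Ux; rewrite -scaler_nat; apply: is_subspaceZ. Qed.

Lemma is_subspaceMz (U : V -> Prop) : is_subspace U ->
  forall x n, U x -> U (x *~ n).
Proof. by move=> UP x n Ux; rewrite -scaler_int; apply: is_subspaceZ. Qed.

Lemma is_subspace_sum (U : V -> Prop) : is_subspace U ->
  forall (I : Type) (r : seq I) (P : pred I) (f : I -> V),
  (forall i, P i -> U (f i)) -> U (\sum_(i <- r | P i) f i).
Proof.
move=> UP I r P f Uf; elim/big_ind: _ => //; first by case: UP.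
exact: is_subspaceD.
Qed.

Lemma span_subspace (P : V -> Prop) : is_subspace (span P).
Proof.
split=> [|a x y Px]; first exact: span_zero.
elim: Px a y => [|b x' x'' Px' _ IH] a y Py; first by rewrite scaler0 add0r.
by rewrite scalerDr scalerA -addrA; apply: span_step => //; apply: IH.
Qed.

Lemma span_gen (P : V -> Prop) x : P x -> span P x.
Proof.
move=> Px; have := span_step 1 Px (span_zero P).
by rewrite scale1r addr0.
Qed.

Lemma span_min (P U : V -> Prop) : is_subspace U ->
  (forall x, P x -> U x) -> forall x, span P x -> U x.
Proof.
move=> UP PU x; elim=> [|a x' y Px _ Uy]; first by case: UP.
by case: UP => _; apply=> //; apply: PU.
Qed.

End LinearAlgebra.

Definition bilin (F : fieldType) (U V W : lmodType F) (f : U -> V -> W) : Prop :=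
  (forall v, linear (f^~ v)) /\ (forall u, linear (f u)).

Section Bilin.
Variables (F : fieldType) (U V W : lmodType F) (f : U -> V -> W).
Hypothesis fP : bilin f.

Lemma bilinDl x y v : f (x + y) v = f x v + f y v.
Proof. by have := fP.1 v 1 x y; rewrite !scale1r. Qed.
Lemma bilinDr u x y : f u (x + y) = f u x + f u y.
Proof. by have := fP.2 u 1 x y; rewrite !scale1r. Qed.
Lemma bilin0l v : f 0 v = 0.
Proof. by apply: (addIr (f 0 v)); rewrite -bilinDl !add0r. Qed.
Lemma bilin0r u : f u 0 = 0.
Proof. by apply: (addIr (f u 0)); rewrite -bilinDr !add0r. Qed.
Lemma bilinZl a x v : f (a *: x) v = a *: f x v.
Proof. by have := fP.1 v a x 0; rewrite !addr0 bilin0l addr0. Qed.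
Lemma bilinZr a u x : f u (a *: x) = a *: f u x.
Proof. by have := fP.2 u a x 0; rewrite !addr0 bilin0r addr0. Qed.
Lemma bilinNl x v : f (- x) v = - f x v.
Proof. by rewrite -scaleN1r bilinZl scaleN1r. Qed.
Lemma bilinNr u x : f u (- x) = - f u x.
Proof. by rewrite -scaleN1r bilinZr scaleN1r. Qed.
Lemma bilin_suml (I : Type) (r : seq I) (P : pred I) (g : I -> U) v :
  f (\sum_(i <- r | P i) g i) v = \sum_(i <- r | P i) f (g i) v.
Proof. by apply: (big_morph (f^~ v) _ (bilin0l v)) => x y; apply: bilinDl. Qed.
Lemma bilin_sumr (I : Type) (r : seq I) (P : pred I) (g : I -> V) u :
  f u (\sum_(i <- r | P i) g i) = \sum_(i <- r | P i) f u (g i).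
Proof. by apply: (big_morph (f u) _ (bilin0r u)) => x y; apply: bilinDr. Qed.
Lemma bilinMnl x v n : f (x *+ n) v = f x v *+ n.
Proof. by rewrite -!scaler_nat bilinZl. Qed.
Lemma bilinMnr u x n : f u (x *+ n) = f u x *+ n.
Proof. by rewrite -!scaler_nat bilinZr. Qed.
Lemma bilinMzl x v n : f (x *~ n) v = f x v *~ n.
Proof. by rewrite -!scaler_int bilinZl. Qed.
Lemma bilinMzr u x n : f u (x *~ n) = f u x *~ n.
Proof. by rewrite -!scaler_int bilinZr. Qed.
End Bilin.

Record subspace (F : fieldType) (V : lmodType F) := Subspace {
  in_subspace :> V -> Prop;
  subspaceP : is_subspace in_subspace }.

Section SubspaceType.
Variables (F : fieldType) (V : lmodType F) (U : subspace V).

Definition subspace_pred : {pred V} := fun x => `[< U x >].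

Lemma subspace_pred_closed : GRing.subsemimod_closed subspace_pred.
Proof.
have UP := subspaceP U; split; [split|].
- by apply/asboolP; case: UP.
- by move=> x y /asboolP Ux /asboolP Uy; apply/asboolP; apply: is_subspaceD.
- by move=> a x /asboolP Ux; apply/asboolP; apply: is_subspaceZ.
Qed.

Definition sub_space : Type := {x : V | subspace_pred x}.

HB.instance Definition _ := SubChoice.on sub_space.
HB.instance Definition _ := GRing.SubChoice_isSubLmodule.Build F V
  subspace_pred sub_space subspace_pred_closed.

Lemma sub_spaceP (x : sub_space) : U (val x).
Proof. exact/asboolP/(valP x). Qed.

Lemma sub_space_valP (a : F) (x y : sub_space) :
  val (a *: x + y) = a *: val x + val y.
Proof. exact: linearP. Qed.

Definition sub_space_mk (x : V) (Ux : U x) : sub_space :=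
  Sub x (introT (asboolP (U x)) Ux).

End SubspaceType.

Section Quotient.
Variables (F : fieldType) (V : lmodType F) (U : subspace V).

Definition quot_rel (x y : V) : bool := `[< U (x - y) >].

Lemma quot_rel_refl : reflexive quot_rel.
Proof. by move=> x; apply/asboolP; rewrite subrr; case: (subspaceP U). Qed.

Lemma quot_rel_sym : symmetric quot_rel.
Proof.
move=> x y; apply/asboolP/asboolP => /(is_subspaceN (subspaceP U));
by rewrite opprB.
Qed.

Lemma quot_rel_trans : transitive quot_rel.
Proof.
move=> y x z /asboolP xy /asboolP yz; apply/asboolP.
by rewrite -(subrK y x) -addrA; apply: is_subspaceD => //; apply: subspaceP.
Qed.

Canonical quot_equiv :=
  EquivRel quot_rel quot_rel_refl quot_rel_sym quot_rel_trans.

Definition quot_space : Type := {eq_quot quot_equiv}.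
HB.instance Definition _ := Choice.on quot_space.

Definition quot_class (x : V) : quot_space := \pi_({eq_quot quot_equiv}) x.
Definition quot_repr (x : quot_space) : V := repr (x : {eq_quot quot_equiv}).

Lemma quot_reprK x : quot_class (quot_repr x) = x.
Proof. exact: reprK. Qed.

Lemma quot_classP x y : quot_class x = quot_class y <-> U (x - y).
Proof.
split=> [/eqmodP/asboolP //|H].
by apply/eqmodP/asboolP.
Qed.

Lemma quot_reprP x : U (quot_repr (quot_class x) - x).
Proof. by apply/quot_classP; rewrite quot_reprK. Qed.

Definition quot_add (x y : quot_space) := quot_class (quot_repr x + quot_repr y).
Definition quot_opp (x : quot_space) := quot_class (- quot_repr x).
Definition quot_scale (a : F) (x : quot_space) := quot_class (a *: quot_repr x).

Lemma quot_addE x y : quot_add (quot_class x) (quot_class y) = quot_class (x + y).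
Proof.
apply/quot_classP; rewrite opprD addrACA.
by apply: is_subspaceD; [exact: subspaceP|exact: quot_reprP|exact: quot_reprP].
Qed.

Lemma quot_oppE x : quot_opp (quot_class x) = quot_class (- x).
Proof.
apply/quot_classP; rewrite -opprD.
by apply: is_subspaceN; [exact: subspaceP|exact: quot_reprP].
Qed.

Lemma quot_scaleE a x : quot_scale a (quot_class x) = quot_class (a *: x).
Proof.
apply/quot_classP; rewrite -scalerBr.
by apply: is_subspaceZ; [exact: subspaceP|exact: quot_reprP].
Qed.

Lemma quot_addA : associative quot_add.
Proof.
move=> x y z; rewrite -(quot_reprK x) -(quot_reprK y) -(quot_reprK z).
by rewrite !quot_addE addrA.
Qed.

Lemma quot_addC : commutative quot_add.
Proof. by move=> x y; rewrite /quot_add addrC. Qed.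

Lemma quot_add0 : left_id (quot_class 0) quot_add.
Proof. by move=> x; rewrite -(quot_reprK x) quot_addE add0r. Qed.

Lemma quot_addN : left_inverse (quot_class 0) quot_opp quot_add.
Proof. by move=> x; rewrite -(quot_reprK x) quot_oppE quot_addE addNr. Qed.

HB.instance Definition _ := GRing.isZmodule.Build quot_space
  quot_addA quot_addC quot_add0 quot_addN.

Lemma quot_scaleA a b v : quot_scale a (quot_scale b v) = quot_scale (a * b) v.
Proof. by rewrite -(quot_reprK v) !quot_scaleE scalerA. Qed.

Lemma quot_scale1 : left_id 1 quot_scale.
Proof. by move=> x; rewrite -(quot_reprK x) quot_scaleE scale1r. Qed.

Lemma quot_scaleDr : right_distributive quot_scale +%R.
Proof.
move=> a x y; rewrite -(quot_reprK x) -(quot_reprK y).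
by rewrite ![_ + _]quot_addE !quot_scaleE [RHS]quot_addE scalerDr.
Qed.

Lemma quot_scaleDl v : {morph quot_scale^~ v : a b / a + b}.
Proof.
move=> a b /=; rewrite -(quot_reprK v).
by rewrite !quot_scaleE [RHS]quot_addE scalerDl.
Qed.

HB.instance Definition _ := GRing.Zmodule_isLmodule.Build F quot_space
  quot_scaleA quot_scale1 quot_scaleDr quot_scaleDl.

Lemma quot_class_linear : linear quot_class.
Proof. by move=> a x y; rewrite -quot_addE -quot_scaleE. Qed.

HB.instance Definition _ :=
  GRing.isLinear.Build F V quot_space _ quot_class quot_class_linear.

End Quotient.

(* K (x)_F V for a field extension iota : F -> K, as the quotient of the formal
   sums of pairs (l, v) in K x V by the congruence generated by the tensor
   product relations *)

Section ExtendScalars.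
Variables (F K : fieldType) (iota : {rmorphism F -> K}) (V : lmodType F).

Inductive tensor_rel : seq (K * V) -> seq (K * V) -> Prop :=
| trel_refl s : tensor_rel s s
| trel_sym s t : tensor_rel s t -> tensor_rel t s
| trel_trans s t r : tensor_rel s t -> tensor_rel t r -> tensor_rel s r
| trel_cat s t s' t' :
    tensor_rel s t -> tensor_rel s' t' -> tensor_rel (s ++ s') (t ++ t')
| trel_comm s t : tensor_rel (s ++ t) (t ++ s)
| trel_zero v : tensor_rel [:: (0, v)] [::]
| trel_addl a b v : tensor_rel [:: (a + b, v)] [:: (a, v); (b, v)]
| trel_addr a v w : tensor_rel [:: (a, v + w)] [:: (a, v); (a, w)]
| trel_balance a (c : F) v : tensor_rel [:: (a * iota c, v)] [:: (a, c *: v)].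

Definition tensor_relb (s t : seq (K * V)) : bool := `[< tensor_rel s t >].

Lemma tensor_relb_refl : reflexive tensor_relb.
Proof. by move=> s; apply/asboolP; apply: trel_refl. Qed.

Lemma tensor_relb_sym : symmetric tensor_relb.
Proof. by move=> s t; apply/asboolP/asboolP => /trel_sym. Qed.

Lemma tensor_relb_trans : transitive tensor_relb.
Proof.
by move=> t s r /asboolP st /asboolP tr; apply/asboolP; apply: trel_trans tr.
Qed.

Canonical tensor_equiv :=
  EquivRel tensor_relb tensor_relb_refl tensor_relb_sym tensor_relb_trans.

Definition ext_space : Type := {eq_quot tensor_equiv}.
HB.instance Definition _ := Choice.on ext_space.

Definition ext_class (s : seq (K * V)) : ext_space :=
  \pi_({eq_quot tensor_equiv}) s.
Definition ext_repr (x : ext_space) : seq (K * V) :=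
  repr (x : {eq_quot tensor_equiv}).

Lemma ext_reprK x : ext_class (ext_repr x) = x.
Proof. exact: reprK. Qed.

Lemma ext_classP s t : ext_class s = ext_class t <-> tensor_rel s t.
Proof. by split=> [/eqmodP/asboolP //|H]; apply/eqmodP/asboolP. Qed.

Lemma ext_reprP s : tensor_rel (ext_repr (ext_class s)) s.
Proof. by apply/ext_classP; rewrite ext_reprK. Qed.

Definition fscale (a : K) (s : seq (K * V)) := [seq (a * p.1, p.2) | p <- s].

Lemma fscale_rel a s t : tensor_rel s t -> tensor_rel (fscale a s) (fscale a t).
Proof.
elim=> {s t} [s|s t _|s t r _ H1 _|s t s' t' _ H1 _ H2|s t|v|b c v|b v w|b c v].
- exact: trel_refl.
- exact: trel_sym.
- exact: trel_trans.
- by rewrite /fscale !map_cat; apply: trel_cat.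
- by rewrite /fscale !map_cat; apply: trel_comm.
- by rewrite /= mulr0; apply: trel_zero.
- by rewrite /= mulrDr; apply: trel_addl.
- exact: trel_addr.
- by rewrite /= mulrA; apply: trel_balance.
Qed.

Definition ext_add (x y : ext_space) := ext_class (ext_repr x ++ ext_repr y).
Definition ext_scale (a : K) (x : ext_space) := ext_class (fscale a (ext_repr x)).

Lemma ext_addE s t : ext_add (ext_class s) (ext_class t) = ext_class (s ++ t).
Proof. by apply/ext_classP; apply: trel_cat; apply: ext_reprP. Qed.

Lemma ext_scaleE a s : ext_scale a (ext_class s) = ext_class (fscale a s).
Proof. by apply/ext_classP; apply/fscale_rel/ext_reprP. Qed.

Lemma ext_addA : associative ext_add.
Proof.
move=> x y z; rewrite -(ext_reprK x) -(ext_reprK y) -(ext_reprK z).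
by rewrite !ext_addE catA.
Qed.

Lemma ext_addC : commutative ext_add.
Proof. by move=> x y; apply/ext_classP/trel_comm. Qed.

Lemma ext_add0 : left_id (ext_class [::]) ext_add.
Proof. by move=> x; rewrite -(ext_reprK x) ext_addE. Qed.

Lemma ext_addN : left_inverse (ext_class [::]) (ext_scale (-1)) ext_add.
Proof.
move=> x; rewrite -(ext_reprK x); elim: (ext_repr x) => [|[a v] s IH].
  by rewrite ext_scaleE ext_addE.
rewrite -(cat1s (a, v) s) -ext_addE.
have -> : ext_scale (-1) (ext_add (ext_class [:: (a, v)]) (ext_class s)) =
  ext_add (ext_scale (-1) (ext_class [:: (a, v)])) (ext_scale (-1) (ext_class s)).
  by rewrite ext_addE !ext_scaleE ext_addE.
rewrite -ext_addA (ext_addC (ext_class [:: (a, v)])) (ext_addA (ext_scale (-1) (ext_class s))).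
rewrite IH ext_add0 ext_scaleE ext_addE /=; apply/ext_classP.
apply: (trel_trans (t := [:: (0, v)])); last exact: trel_zero.
by apply: trel_sym; rewrite mulN1r -[in X in (X, v)](addNr a); apply: trel_addl.
Qed.

HB.instance Definition _ := GRing.isZmodule.Build ext_space
  ext_addA ext_addC ext_add0 ext_addN.

Lemma ext_scaleA a b x : ext_scale a (ext_scale b x) = ext_scale (a * b) x.
Proof.
rewrite -(ext_reprK x) !ext_scaleE /fscale -map_comp; congr ext_class.
by apply: eq_map => p /=; rewrite mulrA.
Qed.

Lemma ext_scale1 : left_id 1 ext_scale.
Proof.
move=> x; rewrite -(ext_reprK x) ext_scaleE /fscale; congr ext_class.
by rewrite -[RHS]map_id; apply: eq_map => -[a v] /=; rewrite mul1r.
Qed.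

Lemma ext_scaleDr : right_distributive ext_scale +%R.
Proof.
move=> a x y; rewrite -(ext_reprK x) -(ext_reprK y).
move: (ext_repr x) (ext_repr y) => s t.
rewrite [ext_class s + _]ext_addE !ext_scaleE [RHS]ext_addE.
by rewrite /fscale map_cat.
Qed.

Lemma ext_scaleDl x : {morph ext_scale^~ x : a b / a + b}.
Proof.
move=> a b /=; rewrite -(ext_reprK x) !ext_scaleE.
elim: (ext_repr x) => [|[c v] s IH]; first by rewrite [RHS]ext_addE.
have E d : ext_class (fscale d ((c, v) :: s)) =
    ext_class [:: (d * c, v)] + ext_class (fscale d s) by rewrite [RHS]ext_addE.
rewrite !E IH addrACA; congr (_ + _); rewrite [RHS]ext_addE mulrDl.
exact/ext_classP/trel_addl.
Qed.

HB.instance Definition _ := GRing.Zmodule_isLmodule.Build K ext_space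
  ext_scaleA ext_scale1 ext_scaleDr ext_scaleDl.

Definition tens (l : K) (v : V) : ext_space := ext_class [:: (l, v)].

Lemma tens_addl a b v : tens (a + b) v = tens a v + tens b v.
Proof. by rewrite [RHS]ext_addE; apply/ext_classP/trel_addl. Qed.

Lemma tens_addr a v w : tens a (v + w) = tens a v + tens a w.
Proof. by rewrite [RHS]ext_addE; apply/ext_classP/trel_addr. Qed.

Lemma tens_scale a b v : a *: tens b v = tens (a * b) v.
Proof. exact: ext_scaleE. Qed.

Lemma tens_balance a c v : tens a (c *: v) = iota c *: tens a v.
Proof.
by rewrite tens_scale mulrC; apply/ext_classP/trel_sym/trel_balance.
Qed.

Lemma tens_zmod a : zmod_morphism (tens a).
Proof.
move=> v w; rewrite tens_addr; congr (_ + _).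
by rewrite -scaleN1r tens_balance rmorphN1 scaleN1r.
Qed.

HB.instance Definition _ a :=
  GRing.isZmodMorphism.Build V ext_space (tens a) (tens_zmod a).

Lemma ext_class_sum s : ext_class s = \sum_(p <- s) tens p.1 p.2.
Proof.
elim: s => [|[a v] s IH]; first by rewrite big_nil.
by rewrite big_cons -IH [RHS]ext_addE.
Qed.

Lemma ext_sum x : x = \sum_(p <- ext_repr x) tens p.1 p.2.
Proof. by rewrite -ext_class_sum ext_reprK. Qed.

Lemma ext_ind (P : ext_space -> Prop) : P 0 ->
  (forall a v x, P x -> P (tens a v + x)) -> forall x, P x.
Proof.
move=> P0 PS x; rewrite (ext_sum x); elim: (ext_repr x) => [|[a v] s IH].
  by rewrite big_nil.
by rewrite big_cons; apply: PS.
Qed.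

Lemma tens_zeror a : tens a 0 = 0.
Proof. exact: raddf0. Qed.

Lemma tens_sub a v w : tens a (v - w) = tens a v - tens a w.
Proof. exact: raddfB. Qed.

Lemma tens_mulrz a v n : tens a (v *~ n) = tens a v *~ n.
Proof. exact: raddfMz. Qed.

End ExtendScalars.

(* The K-linear map on K (x) V induced by an iota-semilinear map g on V *)

Section Lift.
Variables (F K : fieldType) (iota : {rmorphism F -> K}) (V : lmodType F).
Variables (W : lmodType K) (g : V -> W).
Hypothesis gD : forall v w, g (v + w) = g v + g w.
Hypothesis gZ : forall c v, g (c *: v) = iota c *: g v.

Definition fsum_lift (s : seq (K * V)) : W := \sum_(p <- s) p.1 *: g p.2.

Lemma fsum_lift_rel s t : tensor_rel iota s t -> fsum_lift s = fsum_lift t.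
Proof.
rewrite /fsum_lift; elim=> {s t} [//|//|s t r _ -> _ -> //|s t s' t' _ H1 _ H2|s t|v|b c v|b v w|b c v].
- by rewrite !big_cat /= H1 H2.
- by rewrite !big_cat /= addrC.
- by rewrite big_seq1 big_nil scale0r.
- by rewrite big_seq1 big_cons big_seq1 scalerDl.
- by rewrite big_seq1 big_cons big_seq1 /= gD scalerDr.
- by rewrite !big_seq1 /= gZ scalerA.
Qed.
End Lift.

Definition ext_lift (F K : fieldType) (iota : {rmorphism F -> K}) (V : lmodType F)
  (W : lmodType K) (g : V -> W) (x : ext_space iota V) : W :=
  \sum_(p <- ext_repr x) p.1 *: g p.2.

Section Lift2.
Variables (F K : fieldType) (iota : {rmorphism F -> K}) (V : lmodType F).
Variables (W : lmodType K) (g : V -> W).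
Hypothesis gD : forall v w, g (v + w) = g v + g w.
Hypothesis gZ : forall c v, g (c *: v) = iota c *: g v.
Let h : ext_space iota V -> W := ext_lift g.

Lemma ext_lift_class s : h (ext_class iota s) = \sum_(p <- s) p.1 *: g p.2.
Proof. exact: (fsum_lift_rel gD gZ (ext_reprP iota s)). Qed.

Lemma ext_lift_tens a v : h (tens iota a v) = a *: g v.
Proof. by rewrite ext_lift_class big_seq1. Qed.

Lemma ext_lift_linear : linear h.
Proof.
move=> a x y; rewrite -(ext_reprK x) -(ext_reprK y).
rewrite [_ *: ext_class _ _]ext_scaleE [_ + ext_class _ _]ext_addE.
rewrite !ext_lift_class big_cat /= big_map scaler_sumr; congr (_ + _).
by apply: eq_bigr => p _; rewrite scalerA.
Qed.
End Lift2.

(* The K-bilinear extension of f, (l (x) u, m (x) v) |-> l m (x) f u v *)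
Definition ext_op (F K : fieldType) (iota : {rmorphism F -> K})
  (U V W : lmodType F) (f : U -> V -> W)
  (x : ext_space iota U) (y : ext_space iota V) : ext_space iota W :=
  \sum_(p <- ext_repr x) \sum_(q <- ext_repr y)
    tens iota (p.1 * q.1) (f p.2 q.2).

Section ExtOp.
Variables (F K : fieldType) (iota : {rmorphism F -> K}) (U V W : lmodType F).
Variable f : U -> V -> W.
Hypothesis fP : bilin f.
Local Notation fK := (ext_op (iota := iota) f).

Let g (y : ext_space iota V) (u : U) : ext_space iota W :=
  ext_lift (fun v => tens iota 1 (f u v)) y.

Let gE y u : g y u = \sum_(q <- ext_repr y) tens iota q.1 (f u q.2).
Proof. by apply: eq_bigr => q _; rewrite tens_scale mulr1. Qed.

Let ext_opE x y : fK x y = ext_lift (g y) x.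
Proof.
apply: eq_bigr => p _; rewrite gE scaler_sumr.
by apply: eq_bigr => q _; rewrite tens_scale.
Qed.

Let gD y u u' : g y (u + u') = g y u + g y u'.
Proof.
rewrite !gE -big_split; apply: eq_bigr => q _ /=.
by rewrite (bilinDl fP) tens_addr.
Qed.

Let gZ y c u : g y (c *: u) = iota c *: g y u.
Proof.
rewrite !gE scaler_sumr; apply: eq_bigr => q _ /=.
by rewrite (bilinZl fP) tens_balance.
Qed.

Let g_linear u : linear (g^~ u).
Proof.
apply: ext_lift_linear => [v w|c v]; first by rewrite (bilinDr fP) tens_addr.
by rewrite (bilinZr fP) tens_balance.
Qed.

Lemma ext_op_bilin : bilin fK.
Proof.
split=> [y a x x'|x a y y'] /=.
  by rewrite !ext_opE (ext_lift_linear (gD y) (gZ y)).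
rewrite !ext_opE /ext_lift scaler_sumr -big_split; apply: eq_bigr => p _ /=.
by rewrite g_linear scalerDr !scalerA mulrC.
Qed.

Lemma ext_op_tens a u b v :
  fK (tens iota a u) (tens iota b v) = tens iota (a * b) (f u v).
Proof.
rewrite ext_opE (ext_lift_tens (gD _) (gZ _)) /g ext_lift_tens.
- by rewrite !tens_scale mulr1.
- by move=> v' w; rewrite (bilinDr fP) tens_addr.
- by move=> c v'; rewrite (bilinZr fP) tens_balance.
Qed.

End ExtOp.

Section Components.
Variables (F : fieldType) (V : lmodType F) (gr : nat -> V -> Prop).
Hypothesis grP : is_grading gr.

Definition hdeg (v : V) : nat := sval (cid (grading_sum grP v)).
Definition hseq (v : V) : nat -> V := sval (cid (svalP (cid (grading_sum grP v)))).
(* The component of degree n of v; it vanishes for n >= hdeg v *)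
Definition hcomp (n : nat) (v : V) : V := if (n < hdeg v)%N then hseq v n else 0.

Let hseqP v : (forall i, gr i (hseq v i)) /\ v = \sum_(i < hdeg v) hseq v i.
Proof. exact: (svalP (cid (svalP (cid (grading_sum grP v))))). Qed.

Lemma hcomp_gr n v : gr n (hcomp n v).
Proof.
rewrite /hcomp; case: ifP => _; first exact: (hseqP v).1.
by case: (grading_sub grP n).
Qed.

Lemma hcomp_ge n v : (hdeg v <= n)%N -> hcomp n v = 0.
Proof. by rewrite /hcomp ltnNge => ->. Qed.

Lemma hcomp_sumN N v : (hdeg v <= N)%N -> v = \sum_(i < N) hcomp i v.
Proof.
move=> le; rewrite {1}(hseqP v).2 (big_ord_widen N (hseq v) le) big_mkcond /=.
by apply: eq_bigr => i _; rewrite /hcomp.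
Qed.

Lemma hcomp_sum v : v = \sum_(i < hdeg v) hcomp i v.
Proof. exact: hcomp_sumN. Qed.

Lemma hcomp_uniq N (x : nat -> V) v n : (forall i, gr i (x i)) ->
  v = \sum_(i < N) x i -> hcomp n v = if (n < N)%N then x n else 0.
Proof.
move=> xP vE; pose y i := if (i < N)%N then x i else 0.
pose M := maxn n.+1 (maxn N (hdeg v)).
have grN := grading_sub grP.
have : hcomp n v - y n = 0.
  apply: (grading_free grP (N := M) (x := fun i => hcomp i v - y i)) => [i||].
  - apply: is_subspaceB => //; first exact: hcomp_gr.
    by rewrite /y; case: ifP => _ //; case: (grN i).
  - rewrite big_split sumrN /= -hcomp_sumN ?leq_max ?leqnn ?orbT //.
    have NM : (N <= M)%N by rewrite !leq_max leqnn orbT.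
    by rewrite {1}vE (big_ord_widen M x NM) big_mkcond subrr.
  - by rewrite leq_max leqnn.
by move/eqP; rewrite subr_eq0 => /eqP.
Qed.

Lemma hcomp_linear n : linear (hcomp n).
Proof.
move=> a v w; pose M := maxn n.+1 (maxn (hdeg v) (hdeg w)).
have -> : hcomp n (a *: v + w) =
    if (n < M)%N then a *: hcomp n v + hcomp n w else 0.
  apply: (hcomp_uniq (x := fun i => a *: hcomp i v + hcomp i w)) => [i|].
    by apply: (grading_sub grP i).2; apply: hcomp_gr.
  rewrite big_split -scaler_sumr /= -!hcomp_sumN //.
    by rewrite !leq_max leqnn !orbT.
  by rewrite !leq_max leqnn !orbT.
by rewrite leq_max leqnn.
Qed.

Lemma hcomp_hom p v n : gr p v -> hcomp n v = if n == p then v else 0.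
Proof.
move=> vp; have gr0 i : gr i 0 by case: (grading_sub grP i).
rewrite (hcomp_uniq (N := p.+1) (x := fun i => if i == p then v else 0)).
- by case: eqP => [->|_]; rewrite ?ltnSn //; case: ifP.
- by move=> i; case: eqP => [->|].
- rewrite big_ord_recr /= eqxx big1 ?add0r // => i _.
  by rewrite ltn_eqF.
Qed.

End Components.

(* The binomial coefficient m (m - 1) .. (m - i + 1) / i`! for an integer m;
   Negz n is - (n + 1), and 'C(-(n + 1), i) = (-1)^i 'C(n + i, i) *)
Definition binz (m : int) (i : nat) : int :=
  match m with
  | Posz n => Posz 'C(n, i)
  | Negz n => (-1) ^+ i * Posz 'C(n + i, i)
  end.

(* In all that follows a vertex operator Y(u, z) = \sum_n u_n z^(-n-1) is given
   by its modes, Y u n = u_n.  The two sides below are the coefficients of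
   z_0^(-n-1) z_1^(-m-1) z_2^(-k-1) in the two sides of the Jacobi identity
   applied to w:
     \sum_i (-1)^i 'C(n, i) (u_(m+n-i) v_(k+i) w - (-1)^n v_(n+k-i) u_(m+i) w)
       = \sum_i 'C(m, i) (u_(n+i) v)_(m+k-i) w,
   where 'C(m, i) comes from (-1)^i 'C(i-m-1, i) = 'C(m, i).
   All these sums have finitely many nonzero terms by truncation, so the
   identity is that of the partial sums up to every large enough N. *)
Section Jacobi.
Variables (F : fieldType) (V M : lmodType F).
Variables (YV : V -> int -> V -> V) (YM : V -> int -> M -> M).

Definition jacobi_iterate (u v : V) (w : M) (m n k : int) (N : nat) : M :=
  \sum_(i < N) YM (YV u (n + i%:Z) v) (m + k - i%:Z) w *~ binz m i.

Definition jacobi_commutator (u v : V) (w : M) (m n k : int) (N : nat) : M :=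
  \sum_(i < N) (YM u (m + n - i%:Z) (YM v (k + i%:Z) w)
      - YM v (n + k - i%:Z) (YM u (m + i%:Z) w) *~ (-1) ^ n)
    *~ ((-1) ^+ i * binz n i).

Definition jacobi : Prop := forall u v w m n k, eventually (fun N =>
  jacobi_commutator u v w m n k N = jacobi_iterate u v w m n k N).

End Jacobi.

Record is_vertex_algebra (F : fieldType) (V : lmodType F)
    (Y : V -> int -> V -> V) (one : V) : Prop := IsVertexAlgebra {
  va_bilin : forall n, bilin (fun u v => Y u n v);
  va_trunc : forall u v, eventually (fun n => Y u n%:Z v = 0);
  va_vacuum : forall n v, Y one n v = if n == -1 then v else 0;
  va_regular : forall v (n : nat), Y v n%:Z one = 0;
  va_creation : forall v, Y v (-1) one = v;
  va_jacobi : jacobi Y Y }.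

Record voa (F : fieldType) := Voa {
  voa_space :> lmodType F;
  vop : voa_space -> int -> voa_space -> voa_space;
  vacuum : voa_space;
  conformal : voa_space;
  vgr : nat -> voa_space -> Prop;
  voa_va : is_vertex_algebra vop vacuum;
  voa_grading : is_grading vgr;
  voa_fdim : forall n, finite_dim (vgr n);
  voa_vacuum : vgr 0 vacuum;
  voa_conformal : vgr 2 conformal;
  voa_degree : forall (s t : nat) (n : int) u v, vgr s u -> vgr t v ->
    grz vgr (s%:Z + t%:Z - n - 1) (vop u n v);
  voa_virasoro : exists c : F, forall (m n : int) (v : voa_space),
    vop conformal (m + 1) (vop conformal (n + 1) v)
      - vop conformal (n + 1) (vop conformal (m + 1) v) =
    vop conformal (m + n + 1) v *~ (m - n)
      + (if m + n == 0 then (2%:R^-1 * (binz (m + 1) 3)%:~R * c) *: v else 0);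
  voa_derivative : forall v n w,
    vop (vop conformal 0 v) n w = vop v (n - 1) w *~ (- n);
  voa_weight : forall n v, vgr n v -> vop conformal 1 v = v *+ n }.

Arguments vop {F v} : rename.
Arguments vacuum {F} v : rename.
Arguments conformal {F} v : rename.
Arguments vgr {F} v : rename.

Definition Lop (F : fieldType) (V : voa F) (m : int) (v : V) : V :=
  vop (conformal V) (m + 1) v.

Inductive strong_monomial (F : fieldType) (V : voa F) (U : V -> Prop) : V -> Prop :=
| strong_nil : strong_monomial U (vacuum V)
| strong_cons u (n : nat) v : U u -> (1 <= n)%N -> strong_monomial U v ->
    strong_monomial U (vop u (- n%:Z) v).

Definition strongly_finitely_generated (F : fieldType) (V : voa F) : Prop :=
  exists U : V -> Prop, [/\ is_subspace U, finite_dim U &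
    forall v, span (strong_monomial U) v].

Record is_weak_module (F : fieldType) (V : voa F) (M : lmodType F)
    (Y : V -> int -> M -> M) : Prop := IsWeakModule {
  wm_bilin : forall n, bilin (fun u w => Y u n w);
  wm_trunc : forall u w, eventually (fun n => Y u n%:Z w = 0);
  wm_vacuum : forall n w, Y (vacuum V) n w = if n == -1 then w else 0;
  wm_jacobi : jacobi vop Y }.

Record admissible_module (F : fieldType) (V : voa F) := AdmissibleModule {
  adm_space :> lmodType F;
  mop : V -> int -> adm_space -> adm_space;
  mgr : nat -> adm_space -> Prop;
  adm_weak : is_weak_module mop;
  adm_grading : is_grading mgr;
  adm_degree : forall (s t : nat) (n : int) u w, vgr V s u -> mgr t w ->
    grz mgr (s%:Z + t%:Z - n - 1) (mop u n w) }.

Arguments mop {F V a} : rename.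
Arguments mgr {F V} a : rename.

Section AdmissibleModules.
Variables (F : fieldType) (V : voa F) (M : admissible_module V).

Record admissible_submodule (N : M -> Prop) : Prop := AdmissibleSubmodule {
  subm_subspace : is_subspace N;
  subm_stable : forall u n w, N w -> N (mop u n w);
  subm_graded : forall w, N w -> exists (d : nat) (x : nat -> M),
    (forall i, mgr M i (x i) /\ N (x i)) /\ w = \sum_(i < d) x i }.

Definition irreducible_module : Prop :=
  (exists w : M, w <> 0) /\
  forall N, admissible_submodule N -> (forall w, N w -> w = 0) \/ forall w, N w.

Definition End_voa (f : {linear M -> M}) : Prop :=
  forall u n w, f (mop u n w) = mop u n (f w).

End AdmissibleModules.

Definition is_scalars (F : fieldType) (S : lmodType F)
    (E : {linear S -> S} -> Prop) : Prop :=
  forall f, E f <-> exists c : F, forall x, f x = c *: x.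

(* A unital associative algebra, possibly zero *)
Record assoc_algebra (F : fieldType) := AssocAlgebra {
  alg_space :> lmodType F;
  amul : alg_space -> alg_space -> alg_space;
  aone : alg_space;
  amul_bilin : bilin amul;
  amulA : associative amul;
  amul1l : left_id aone amul;
  amul1r : right_id aone amul }.

Record alg_module (F : fieldType) (A : assoc_algebra F) := AlgModule {
  amod_space :> lmodType F;
  act : A -> amod_space -> amod_space;
  act_bilin : bilin act;
  act1 : forall x, act (aone A) x = x;
  actM : forall a b x, act (amul a b) x = act a (act b x) }.

Arguments act {F A a} : rename.

Section AlgModules.
Variables (F : fieldType) (A : assoc_algebra F) (S : alg_module A).

Definition simple_module : Prop :=
  (exists x : S, x <> 0) /\
  forall N : S -> Prop, is_subspace N -> (forall a x, N x -> N (act a x)) ->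
    (forall x, N x -> x = 0) \/ forall x, N x.

Definition End_alg (f : {linear S -> S}) : Prop :=
  forall a x, f (act a x) = act a (f x).

End AlgModules.

Section ExtendSubspace.
Variables (F K : fieldType) (iota : {rmorphism F -> K}) (V : lmodType F).

Definition ext_sub (U : V -> Prop) : ext_space iota V -> Prop :=
  span (fun x => exists a v, U v /\ x = tens iota a v).

Lemma ext_sub_tens (U : V -> Prop) a v : U v -> ext_sub U (tens iota a v).
Proof. by move=> Uv; apply: span_gen; exists a, v. Qed.

Lemma ext_sub_min (U : V -> Prop) (P : ext_space iota V -> Prop) :
  is_subspace P -> (forall a v, U v -> P (tens iota a v)) ->
  forall x, ext_sub U x -> P x.
Proof. by move=> PP UP; apply: span_min => // x [a [v [Uv ->]]]; apply: UP. Qed.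

Lemma ext_sub_fdim U : finite_dim U -> finite_dim (ext_sub U).
Proof.
move=> [d [b [Ub bP]]]; exists d, (fun i => tens iota 1 (b i)); split=> [i|].
  exact: ext_sub_tens.
apply: ext_sub_min => [|a v /bP[c ->]].
  split=> [|a x y [c ->] [e ->]].
    by exists (fun=> 0); rewrite big1 // => i _; rewrite scale0r.
  exists (fun i => a * c i + e i); rewrite scaler_sumr -big_split.
  by apply: eq_bigr => i _; rewrite scalerA scalerDl.
exists (fun i => a * iota (c i)); rewrite raddf_sum; apply: eq_bigr => i _.
by rewrite /= tens_balance !tens_scale mulr1 mulrC.
Qed.

Section Grading.
Variables (gr : nat -> V -> Prop) (grP : is_grading gr).

Definition ext_gr (n : nat) : ext_space iota V -> Prop := ext_sub (gr n).

Let pr (n : nat) : ext_space iota V -> ext_space iota V :=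
  ext_lift (fun v => tens iota 1 (hcomp grP n v)).

Let prL n : linear (pr n).
Proof.
have L := hcomp_linear grP n.
apply: ext_lift_linear => [v w|c v].
  by have := L 1 v w; rewrite !scale1r => ->; rewrite tens_addr.
have L0 : hcomp grP n 0 = 0.
  by rewrite (hcomp_hom grP (p := n)) ?if_same //; case: (grading_sub grP n).
by have := L c v 0; rewrite !addr0 L0 addr0 => ->; rewrite tens_balance.
Qed.

Let prD n x y : pr n (x + y) = pr n x + pr n y.
Proof. by have := prL n 1 x y; rewrite !scale1r. Qed.

Let pr0 n : pr n 0 = 0.
Proof. by apply: (addIr (pr n 0)); rewrite -prD !add0r. Qed.

Let pr_tens n a v : pr n (tens iota a v) = tens iota a (hcomp grP n v).
Proof.
have L := hcomp_linear grP n.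
rewrite /pr ext_lift_tens ?tens_scale ?mulr1 // => [v' w|c v'].
  by have := L 1 v' w; rewrite !scale1r => ->; rewrite tens_addr.
have L0 : hcomp grP n 0 = 0.
  by rewrite (hcomp_hom grP (p := n)) ?if_same //; case: (grading_sub grP n).
by have := L c v' 0; rewrite !addr0 L0 addr0 => ->; rewrite tens_balance.
Qed.

Let pr_gr n p x : ext_gr p x -> pr n x = if n == p then x else 0.
Proof.
move: x; apply: ext_sub_min => [|a v vp].
  split=> [|a x y Hx Hy]; first by rewrite pr0 if_same.
  by rewrite prL Hx Hy; case: eqP => _ //; rewrite scaler0 addr0.
rewrite pr_tens (hcomp_hom grP (p := p)) //.
by case: eqP => // _; rewrite tens_zeror.
Qed.

Lemma ext_grading : is_grading ext_gr.
Proof.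
split=> [n|x|N x xP x0 i iN]; first exact: span_subspace.
- elim/ext_ind: x => [|a v x [N [y [yP ->]]]].
    exists 0%N, (fun=> 0); split=> [i|]; last by rewrite big_ord0.
    exact: span_zero.
  have gr0 i : ext_gr i 0 by apply: span_zero.
  pose M := maxn N (hdeg grP v).
  have NM : (N <= M)%N by rewrite leq_maxl.
  exists M, (fun i => tens iota a (hcomp grP i v) + if (i < N)%N then y i else 0).
  split=> [i|].
    apply: is_subspaceD; first exact: span_subspace.
      by apply: ext_sub_tens; apply: hcomp_gr.
    by case: ifP.
  rewrite big_split /= -raddf_sum -hcomp_sumN ?leq_maxr //.
  by rewrite -big_mkcond -(big_ord_widen M y NM).
- have := congr1 (pr i) x0.
  rewrite (big_morph (pr i) (prD i) (pr0 i)) pr0.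
  rewrite (bigD1 (Ordinal iN)) //= (pr_gr _ (xP i)) eqxx big1 ?addr0 //.
  move=> j ji; rewrite (pr_gr _ (xP j)); case: eqP => // ij.
  by case/eqP: ji; apply: val_inj.
Qed.

End Grading.
End ExtendSubspace.

Section Eventually.
Lemma eventually_true (P : nat -> Prop) : (forall n, P n) -> eventually P.
Proof. by exists 0%N => N _. Qed.

Lemma eventually_and (P Q : nat -> Prop) :
  eventually P -> eventually Q -> eventually (fun n => P n /\ Q n).
Proof.
move=> [a Pa] [b Qb]; exists (maxn a b) => N; rewrite geq_max => /andP[aN bN].
by split; [apply: Pa|apply: Qb].
Qed.

Lemma eventually_mono (P Q : nat -> Prop) :
  (forall n, P n -> Q n) -> eventually P -> eventually Q.
Proof. by move=> PQ [a Pa]; exists a => N /Pa/PQ. Qed.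

Lemma eventually_and_mono (P Q R : nat -> Prop) :
  (forall n, P n -> Q n -> R n) -> eventually P -> eventually Q -> eventually R.
Proof.
move=> PQR Pe Qe; apply: eventually_mono (eventually_and Pe Qe) => n [].
exact: PQR.
Qed.

Lemma eventually_sum0 (T : zmodType) (f g h : nat -> T) :
  (forall N, h N = f N + g N) -> eventually (fun N => f N = 0) ->
  eventually (fun N => g N = 0) -> eventually (fun N => h N = 0).
Proof.
by move=> hE; apply: eventually_and_mono => N f0 g0; rewrite hE f0 g0 addr0.
Qed.

Lemma eventually_bounded (P : nat -> nat -> Prop) (b : nat) :
  (forall i, eventually (P i)) ->
  eventually (fun n => forall i, (i < b)%N -> P i n).
Proof.
move=> H; elim: b => [|b IH]; first exact: eventually_true.
apply: eventually_and_mono IH (H b) => n Hn Pb i.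
by rewrite ltnS leq_eqVlt => /orP[/eqP->|/Hn].
Qed.

End Eventually.

Section JacobiLinear.
Variables (F : fieldType) (V M : lmodType F).
Variables (YV : V -> int -> V -> V) (YM : V -> int -> M -> M).
Hypothesis YVb : forall n, bilin (fun u v => YV u n v).
Hypothesis YMb : forall n, bilin (fun u v => YM u n v).

Let jacobi_termD (a a' b b' e e' : M) (s c d : int) :
  (a + a' - (b + b') *~ s) *~ c - (e + e') *~ d =
  ((a - b *~ s) *~ c - e *~ d) + ((a' - b' *~ s) *~ c - e' *~ d).
Proof.
have H (x x' y y' : M) : x + x' - (y + y') = (x - y) + (x' - y').
  by rewrite opprD addrACA.
by rewrite [(b + b') *~ s]mulrzDl H !mulrzDl H.
Qed.

Lemma jacobi_linearl v w m n k N :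
  {morph (fun u => jacobi_commutator YM u v w m n k N
                   - jacobi_iterate YV YM u v w m n k N) : x y / x + y}.
Proof.
move=> x y; rewrite /jacobi_commutator /jacobi_iterate -!sumrB -big_split.
apply: eq_bigr => i _ /=.
rewrite (bilinDl (YVb _)) !(bilinDl (YMb _)) (bilinDr (YMb _)).
exact: jacobi_termD.
Qed.

Lemma jacobi_linearm u w m n k N :
  {morph (fun v => jacobi_commutator YM u v w m n k N
                   - jacobi_iterate YV YM u v w m n k N) : x y / x + y}.
Proof.
move=> x y; rewrite /jacobi_commutator /jacobi_iterate -!sumrB -big_split.
apply: eq_bigr => i _ /=.
rewrite (bilinDr (YVb _)) !(bilinDl (YMb _)) (bilinDr (YMb _)).
exact: jacobi_termD.
Qed.

Lemma jacobi_linearr u v m n k N :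
  {morph (fun w => jacobi_commutator YM u v w m n k N
                   - jacobi_iterate YV YM u v w m n k N) : x y / x + y}.
Proof.
move=> x y; rewrite /jacobi_commutator /jacobi_iterate -!sumrB -big_split.
apply: eq_bigr => i _ /=.
rewrite !(bilinDr (YMb _)).
exact: jacobi_termD.
Qed.
End JacobiLinear.

Section ExtendJacobi.
Variables (F K : fieldType) (iota : {rmorphism F -> K}) (V M : lmodType F).
Variables (YV : V -> int -> V -> V) (YM : V -> int -> M -> M).
Hypothesis YVb : forall n, bilin (fun u v => YV u n v).
Hypothesis YMb : forall n, bilin (fun u v => YM u n v).

Let YVK (x : ext_space iota V) (n : int) (y : ext_space iota V) :=
  ext_op (fun u v => YV u n v) x y.
Let YMK (x : ext_space iota V) (n : int) (y : ext_space iota M) :=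
  ext_op (fun u v => YM u n v) x y.

Lemma ext_jacobi : jacobi YV YM -> jacobi YVK YMK.
Proof.
have bV n : bilin (fun x y => YVK x n y) by apply: ext_op_bilin.
have bM n : bilin (fun x y => YMK x n y) by apply: ext_op_bilin.
have EV a u n b v : YVK (tens iota a u) n (tens iota b v)
  = tens iota (a * b) (YV u n v) by apply: ext_op_tens.
have EM a u n b v : YMK (tens iota a u) n (tens iota b v)
  = tens iota (a * b) (YM u n v) by apply: ext_op_tens.
move=> J x y z m n k.
pose D x y z N := jacobi_commutator YMK x y z m n k N
                  - jacobi_iterate YVK YMK x y z m n k N.
suff : eventually (fun N => D x y z N = 0).
  by apply: eventually_mono => N /eqP; rewrite subr_eq0 => /eqP.
have Dl y' z' N : {morph (fun t => D t y' z' N) : s t / s + t}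
  by apply: jacobi_linearl.
have Dm x' z' N : {morph (fun t => D x' t z' N) : s t / s + t}
  by apply: jacobi_linearm.
have Dr x' y' N : {morph (fun t => D x' y' t N) : s t / s + t}
  by apply: jacobi_linearr.
elim/ext_ind: x => [|a u x IHx].
  by apply: eventually_true => N; apply: (addIr (D 0 y z N)); rewrite -Dl !add0r.
apply: (eventually_sum0 (fun N => Dl _ _ N _ _)) _ IHx.
elim/ext_ind: y => [|b v y IHy].
  apply: eventually_true => N; apply: (addIr (D (tens iota a u) 0 z N)).
  by rewrite -Dm !add0r.
apply: (eventually_sum0 (fun N => Dm _ _ N _ _)) _ IHy.
elim/ext_ind: z => [|c w z IHz].
  apply: eventually_true => N; apply: (addIr (D (tens iota a u) (tens iota b v) 0 N)).
  by rewrite -Dr !add0r.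
apply: (eventually_sum0 (fun N => Dr _ _ N _ _)) _ IHz.
apply: eventually_mono (J u v w m n k) => N JN.
have -> : D (tens iota a u) (tens iota b v) (tens iota c w) N =
  tens iota (a * b * c) (jacobi_commutator YM u v w m n k N)
  - tens iota (a * b * c) (jacobi_iterate YV YM u v w m n k N).
  rewrite /D /jacobi_commutator /jacobi_iterate; congr (_ - _).
    rewrite raddf_sum; apply: eq_bigr => i _; rewrite /= !EM tens_mulrz tens_sub tens_mulrz.
    by rewrite !mulrA (mulrC b a).
  by rewrite raddf_sum; apply: eq_bigr => i _; rewrite /= EV EM tens_mulrz.
by rewrite JN subrr.
Qed.

Lemma ext_trunc : (forall u w, eventually (fun n => YM u n%:Z w = 0)) ->
  forall x y, eventually (fun n => YMK x n%:Z y = 0).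
Proof.
have bM n : bilin (fun x y => YMK x n y) by apply: ext_op_bilin.
move=> T x y; elim/ext_ind: x => [|a u x IHx].
  by apply: eventually_true => n; rewrite (bilin0l (bM _)).
apply: (eventually_sum0 (fun n => bilinDl (bM n%:Z) _ _ _)) _ IHx.
elim/ext_ind: y => [|b v y IHy].
  by apply: eventually_true => n; rewrite (bilin0r (bM _)).
apply: (eventually_sum0 (fun n => bilinDr (bM n%:Z) _ _ _)) _ IHy.
apply: eventually_mono (T u v) => n Yn; rewrite /YMK ext_op_tens // Yn.
exact: tens_zeror.
Qed.

Lemma ext_degree (grV : nat -> V -> Prop) (grM : nat -> M -> Prop) :
  is_grading grM ->
  (forall (s t : nat) (n : int) u w, grV s u -> grM t w ->
    grz grM (s%:Z + t%:Z - n - 1) (YM u n w)) ->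
  forall (s t : nat) (n : int) x y, ext_gr (iota := iota) grV s x ->
    ext_gr (iota := iota) grM t y ->
    grz (ext_gr grM) (s%:Z + t%:Z - n - 1) (YMK x n y).
Proof.
have bM n : bilin (fun x y => YMK x n y) by apply: ext_op_bilin.
move=> grMP D s t n x y.
have Zsub i : is_subspace (grz (ext_gr (iota := iota) grM) i).
  case: i => i /=; first exact: span_subspace.
  by split=> // a x' y' -> ->; rewrite scaler0 addr0.
move=> xs yt; move: x xs; apply: ext_sub_min => [|a u us].
  split=> [|a x x' Px Px']; first by rewrite (bilin0l (bM _)); apply: (Zsub _).1.
  by rewrite (bilinDl (bM _)) (bilinZl (bM _)); apply: (Zsub _).2.
move: y yt; apply: ext_sub_min => [|b w wt].
  split=> [|b y y' Py Py']; first by rewrite (bilin0r (bM _)); apply: (Zsub _).1.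
  by rewrite (bilinDr (bM _)) (bilinZr (bM _)); apply: (Zsub _).2.
rewrite /YMK ext_op_tens //; move: (D s t n u w us wt).
case: (_ - 1) => i /=; first exact: ext_sub_tens.
by move=> ->; rewrite tens_zeror.
Qed.

End ExtendJacobi.

Section ExtendVoa.
Variables (F K : fieldType) (iota : {rmorphism F -> K}) (V : voa F).
Local Notation VK := (ext_space iota V).
Local Notation T := (tens iota).

Definition ext_vop (x : VK) (n : int) (y : VK) : VK :=
  ext_op (fun u v : V => vop u n v) x y.

Let Yb n : bilin (fun u v : V => vop u n v) := va_bilin (voa_va V) n.
Let YKb n : bilin (fun x y => ext_vop x n y) := ext_op_bilin iota (Yb n).
Let YKE a u n b v : ext_vop (T a u) n (T b v) = T (a * b) (vop u n v).
Proof. exact: ext_op_tens. Qed.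

Lemma ext_va : is_vertex_algebra ext_vop (T 1 (vacuum V)).
Proof.
have VP := voa_va V; split=> //.
- exact: ext_trunc (va_trunc VP).
- move=> n x; elim/ext_ind: x => [|a v x IH].
    by rewrite (bilin0r (YKb n)) if_same.
  rewrite (bilinDr (YKb n)) IH YKE mul1r (va_vacuum VP).
  by case: eqP => // _; rewrite tens_zeror addr0.
- move=> x n; elim/ext_ind: x => [|a v x IH]; first exact: (bilin0l (YKb n)).
  by rewrite (bilinDl (YKb n)) IH YKE (va_regular VP) tens_zeror addr0.
- move=> x; elim/ext_ind: x => [|a v x IH]; first exact: (bilin0l (YKb (-1))).
  by rewrite (bilinDl (YKb (-1))) IH YKE (va_creation VP) mulr1.
- exact: ext_jacobi (va_jacobi VP).
Qed.

Let wK := T 1 (conformal V).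

Lemma ext_virasoro : exists c : K, forall (m n : int) (x : VK),
  ext_vop wK (m + 1) (ext_vop wK (n + 1) x)
      - ext_vop wK (n + 1) (ext_vop wK (m + 1) x) =
    ext_vop wK (m + n + 1) x *~ (m - n)
      + (if m + n == 0 then (2%:R^-1 * (binz (m + 1) 3)%:~R * c) *: x else 0).
Proof.
have [c Vc] := voa_virasoro V; exists (iota c) => m n x.
elim/ext_ind: x => [|a v x IH].
  rewrite !(bilin0r (YKb _)) subrr mul0rz add0r.
  by rewrite scaler0 if_same.
rewrite !(bilinDr (YKb _)) opprD addrACA IH !YKE !mul1r -tens_sub Vc.
rewrite tens_addr tens_mulrz mulrzDl addrACA; congr (_ + _ + _).
case: eqP => _; last by rewrite tens_zeror add0r.
by rewrite scalerDr tens_balance !rmorphM fmorphV rmorph_nat rmorph_int.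
Qed.

Lemma ext_derivative x n y :
  ext_vop (ext_vop wK 0 x) n y = ext_vop x (n - 1) y *~ (- n).
Proof.
elim/ext_ind: x => [|a u x IHx].
  by rewrite (bilin0r (YKb _)) !(bilin0l (YKb _)) mul0rz.
rewrite (bilinDr (YKb _)) !(bilinDl (YKb _)) IHx mulrzDl; congr (_ + _).
elim/ext_ind: y {IHx} => [|b v y IHy]; first by rewrite !(bilin0r (YKb _)) mul0rz.
rewrite !(bilinDr (YKb _)) IHy mulrzDl; congr (_ + _).
by rewrite !YKE mul1r voa_derivative tens_mulrz.
Qed.

Lemma ext_weight n x : ext_gr (iota := iota) (vgr V) n x ->
  ext_vop wK 1 x = x *+ n.
Proof.
move: x; apply: ext_sub_min => [|a v vn].
  split=> [|a x y Px Py]; first by rewrite (bilin0r (YKb _)) mul0rn.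
  by rewrite (bilinDr (YKb _)) (bilinZr (YKb _)) Px Py mulrnDl scalerMnr.
by rewrite YKE mul1r (voa_weight vn) raddfMn.
Qed.

Definition ext_voa : voa K := {|
  voa_space := VK;
  vop := ext_vop;
  vacuum := T 1 (vacuum V);
  conformal := wK;
  vgr := ext_gr (vgr V);
  voa_va := ext_va;
  voa_grading := ext_grading iota (voa_grading V);
  voa_fdim := fun n => ext_sub_fdim iota (voa_fdim V n);
  voa_vacuum := ext_sub_tens iota 1 (voa_vacuum V);
  voa_conformal := ext_sub_tens iota 1 (voa_conformal V);
  voa_degree := ext_degree Yb (voa_grading V) (@voa_degree F V);
  voa_virasoro := ext_virasoro;
  voa_derivative := ext_derivative;
  voa_weight := ext_weight |}.

Variable M : admissible_module V.
Local Notation MK := (ext_space iota M).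

Definition ext_mop (x : ext_voa) (n : int) (y : MK) : MK :=
  ext_op (fun (u : V) (w : M) => mop u n w) x y.

Let MYb n : bilin (fun (u : V) (w : M) => mop u n w) := wm_bilin (adm_weak M) n.
Let MYKb n : bilin (fun x y => ext_mop x n y) := ext_op_bilin iota (MYb n).

Lemma ext_weak : is_weak_module ext_mop.
Proof.
have MP := adm_weak M; split=> //.
- exact: ext_trunc (wm_trunc MP).
- move=> n y; elim/ext_ind: y => [|a w y IH].
    by rewrite (bilin0r (MYKb n)) if_same.
  rewrite (bilinDr (MYKb n)) IH /ext_mop ext_op_tens // mul1r (wm_vacuum MP).
  by case: eqP => // _; rewrite tens_zeror addr0.
- exact: ext_jacobi (wm_jacobi MP).
Qed.

Definition ext_module : admissible_module ext_voa := {|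
  adm_space := MK;
  mop := ext_mop;
  mgr := ext_gr (mgr M);
  adm_weak := ext_weak;
  adm_grading := ext_grading iota (adm_grading M);
  adm_degree := ext_degree MYb (adm_grading M) (@adm_degree F V M) |}.

End ExtendVoa.

Definition absolutely_irreducible (F : fieldType) (V : voa F)
    (M : admissible_module V) : Prop :=
  irreducible_module M /\
  forall (K : fieldType) (iota : {rmorphism F -> K}),
    irreducible_module (ext_module iota M).

Section ExtendAlgebra.
Variables (F K : fieldType) (iota : {rmorphism F -> K}) (A : assoc_algebra F).
Local Notation AK := (ext_space iota A).
Local Notation T := (tens iota).

Definition ext_amul (x y : AK) : AK := ext_op (@amul F A) x y.

Let mb : bilin ext_amul := ext_op_bilin iota (amul_bilin A).
Let mE a u b v : ext_amul (T a u) (T b v) = T (a * b) (amul u v).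
Proof. exact: (ext_op_tens iota (amul_bilin A)). Qed.

Lemma ext_amulA : associative ext_amul.
Proof.
move=> x y z; elim/ext_ind: x => [|a u x IHx]; first by rewrite !(bilin0l mb).
rewrite !(bilinDl mb) IHx; congr (_ + _).
elim/ext_ind: y {IHx} => [|b v y IHy].
  by rewrite (bilin0l mb) !(bilin0r mb) (bilin0l mb).
rewrite (bilinDl mb) !(bilinDr mb) (bilinDl mb) IHy; congr (_ + _).
elim/ext_ind: z {IHy} => [|c w z IHz]; first by rewrite !(bilin0r mb).
rewrite !(bilinDr mb) IHz; congr (_ + _).
by rewrite !mE mulrA amulA.
Qed.

Lemma ext_amul1l : left_id (T 1 (aone A)) ext_amul.
Proof.
move=> x; elim/ext_ind: x => [|a u x IHx]; first by rewrite (bilin0r mb).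
by rewrite (bilinDr mb) IHx mE mul1r amul1l.
Qed.

Lemma ext_amul1r : right_id (T 1 (aone A)) ext_amul.
Proof.
move=> x; elim/ext_ind: x => [|a u x IHx]; first by rewrite (bilin0l mb).
by rewrite (bilinDl mb) IHx mE mulr1 amul1r.
Qed.

Definition ext_algebra : assoc_algebra K := {|
  alg_space := AK;
  amul := ext_amul;
  aone := T 1 (aone A);
  amul_bilin := mb;
  amulA := ext_amulA;
  amul1l := ext_amul1l;
  amul1r := ext_amul1r |}.

Variable S : alg_module A.
Local Notation SK := (ext_space iota S).

Definition ext_act (x : ext_algebra) (y : SK) : SK :=
  ext_op (fun (a : A) (s : S) => act a s) x y.

Let ab : bilin ext_act := ext_op_bilin iota (act_bilin S).
Let aE a u b v : ext_act (T a u) (T b v) = T (a * b) (act u v).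
Proof. exact: (ext_op_tens iota (act_bilin S)). Qed.

Lemma ext_act1 y : ext_act (aone ext_algebra) y = y.
Proof.
elim/ext_ind: y => [|a s y IH]; first by rewrite (bilin0r ab).
by rewrite (bilinDr ab) IH aE mul1r act1.
Qed.

Lemma ext_actM (x y : ext_algebra) z :
  ext_act (amul x y) z = ext_act x (ext_act y z).
Proof.
change (ext_act (ext_amul x y) z = ext_act x (ext_act y z)).
elim/ext_ind: x => [|a u x IHx]; first by rewrite (bilin0l mb) !(bilin0l ab).
rewrite (bilinDl mb) !(bilinDl ab) IHx; congr (_ + _).
elim/ext_ind: y {IHx} => [|b v y IHy].
  by rewrite (bilin0r mb) !(bilin0l ab) (bilin0r ab).
rewrite (bilinDr mb) !(bilinDl ab) (bilinDr ab) IHy; congr (_ + _).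
elim/ext_ind: z {IHy} => [|c w z IHz]; first by rewrite !(bilin0r ab).
rewrite !(bilinDr ab) IHz; congr (_ + _).
by rewrite mE !aE actM mulrA.
Qed.

Definition ext_alg_module : alg_module ext_algebra := {|
  amod_space := SK;
  act := ext_act;
  act_bilin := ab;
  act1 := ext_act1;
  actM := ext_actM |}.

End ExtendAlgebra.

Definition absolutely_simple (F : fieldType) (A : assoc_algebra F)
    (S : alg_module A) : Prop :=
  simple_module S /\
  forall (K : fieldType) (iota : {rmorphism F -> K}),
    simple_module (ext_alg_module iota S).

Lemma trinomial (a p i : nat) : (i <= p <= a)%N ->
  ('C(a, p) * 'C(p, i) = 'C(a, i) * 'C(a - i, p - i))%N.
Proof.
move=> /andP[ip pa]; have ia := leq_trans ip pa.
have pos : (0 < i`! * (p - i)`! * (a - p)`!)%N by rewrite !muln_gt0 !fact_gt0.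
apply/eqP; rewrite -(eqn_pmul2r pos); apply/eqP.
have E1 := bin_fact pa; have E2 := bin_fact ip; have E3 := bin_fact ia.
have E4 : ('C(a - i, p - i) * ((p - i)`! * (a - p)`!) = (a - i)`!)%N.
  have -> : (a - p = a - i - (p - i))%N by rewrite subnBA // subnK.
  by rewrite bin_fact // leq_sub2r.
transitivity (a`!)%N.
  by rewrite -E1 -E2 -!mulnA.
rewrite -E3 -E4; move: 'C(a, i) 'C(a - i, p - i) (i`!) ((p - i)`!) ((a - p)`!).
by move=> c1 c2 f1 f2 f3; rewrite -!mulnA; congr (_ * _)%N; rewrite !mulnA (mulnC c2).
Qed.

Lemma binz_pred (p l : nat) :
  binz (p%:Z - 1) l = \sum_(i < l.+1) (-1) ^+ (l - i) * 'C(p, i)%:Z.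
Proof.
case: p => [|p].
  rewrite sub0r /= add0n binn mulr1 big_ord_recl subn0 bin0 mulr1.
  by rewrite big1 ?addr0 // => i _; rewrite bin0n mulr0.
have -> : p.+1%:Z - 1 = p by rewrite -addn1 PoszD addrK.
elim: l => [|l IH]; first by rewrite big_ord1 /= !bin0 mulr1.
rewrite big_ord_recr subnn mul1r /=.
rewrite (eq_bigr (fun i : 'I_l.+1 => - ((-1) ^+ (l - i) * 'C(p.+1, i)%:Z))).
  by rewrite sumrN -IH /= binS PoszD addrC addrK.
by move=> i _; rewrite subSn ?exprS ?mulN1r ?mulNr // -ltnS.
Qed.

(* Res_z of (\sum_n x_n z^(-n-1)) (1 + z)^a *)
Definition bsum (T : zmodType) (a : nat) (x : nat -> T) : T :=
  \sum_(i < a.+1) x i *+ 'C(a, i).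

Section Bsum.
Variable T : zmodType.
Implicit Types x y z : nat -> T.

Lemma bsum_widen a N x : (a < N)%N -> bsum a x = \sum_(i < N) x i *+ 'C(a, i).
Proof.
move=> aN; rewrite /bsum (big_ord_widen N (fun i => x i *+ 'C(a, i)) aN).
rewrite big_mkcond; apply: eq_bigr => i _; case: ifP => // /negbT.
by rewrite -leqNgt => ai; rewrite bin_small.
Qed.

Lemma eq_bsum a x y : (forall i, (i <= a)%N -> x i = y i) -> bsum a x = bsum a y.
Proof. by move=> xy; apply: eq_bigr => i _; rewrite xy // -ltnS. Qed.

Lemma bsum0 a x : (forall i, (i <= a)%N -> x i = 0) -> bsum a x = 0.
Proof. by move=> x0; rewrite /bsum big1 // => i _; rewrite x0 ?mul0rn // -ltnS. Qed.

Lemma bsum_sum a (I : Type) (r : seq I) (x : nat -> I -> T) :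
  bsum a (fun p => \sum_(i <- r) x p i) = \sum_(i <- r) bsum a (x^~ i).
Proof.
by rewrite exchange_big; apply: eq_bigr => p _; rewrite sumrMnl.
Qed.

Lemma bsumD a x y : bsum a (fun p => x p + y p) = bsum a x + bsum a y.
Proof. by rewrite -big_split; apply: eq_bigr => i _; rewrite mulrnDl. Qed.

Lemma bsumB a x y : bsum a (fun p => x p - y p) = bsum a x - bsum a y.
Proof. by rewrite -sumrB; apply: eq_bigr => i _; rewrite mulrnBl. Qed.

Lemma bsum_mulrz a x c : bsum a (fun p => x p *~ c) = bsum a x *~ c.
Proof.
rewrite /bsum (big_morph (fun t : T => t *~ c) (fun t s => mulrzDl _ t s) (mul0rz _ c)).
by apply: eq_bigr => i _; rewrite !pmulrn mulrzAC.
Qed.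

Lemma bsum_mulrn a x c : bsum a (fun p => x p *+ c) = bsum a x *+ c.
Proof. exact: (bsum_mulrz a x c%:Z). Qed.

Lemma exchange_bsum a b (x : nat -> nat -> T) :
  bsum a (fun p => bsum b (x p)) = bsum b (fun q => bsum a (x^~ q)).
Proof.
rewrite /bsum; under eq_bigr => p _ do rewrite -sumrMnl.
rewrite exchange_big /=; apply: eq_bigr => q _; rewrite -sumrMnl.
by apply: eq_bigr => p _; rewrite mulrnAC.
Qed.

Lemma bsumS a x : bsum a.+1 x = bsum a x + bsum a (fun i => x i.+1).
Proof.
rewrite (bsum_widen (a := a) (N := a.+2) x (ltnW _)) // /bsum.
rewrite [LHS]big_ord_recl [X in _ = X + _]big_ord_recl !bin0 -addrA.
congr (_ + _); rewrite -big_split /=; apply: eq_bigr => i _.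
by rewrite /bump /= add1n binS mulrnDr.
Qed.

Lemma bsum_add a b x : bsum a (fun p => bsum b (fun q => x (p + q)%N)) = bsum (a + b) x.
Proof.
elim: a x => [|a IH] x; first by rewrite [LHS]big_ord1 /= bin0 mulr1n.
by rewrite bsumS addSn bsumS -IH -(IH (fun i => x i.+1)).
Qed.

Lemma bsum_bin a i x : bsum a (fun p => x p *+ 'C(p, i)) =
  bsum (a - i) (fun p => x (i + p)%N) *+ 'C(a, i).
Proof.
case: (leqP i a) => ia; last first.
  by rewrite bin_small // mulr0n bsum0 // => p pa; rewrite bin_small // (leq_ltn_trans pa).
rewrite /bsum -[LHS](big_mkord xpredT (fun p => x p *+ 'C(p, i) *+ 'C(a, p))).
rewrite (big_cat_nat (n := i)) //=; last exact: leqW.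
rewrite big1_seq ?add0r => [|p]; last first.
  by rewrite mem_index_iota /= => pi; rewrite bin_small ?mul0rn.
rewrite -{1}[i]add0n big_addn subSn // big_mkord -sumrMnl; apply: eq_bigr => p _.
have pa : (p + i <= a)%N by rewrite addnC -leq_subRL // -ltnS.
by rewrite -!mulrnA mulnC trinomial ?leq_addl // addnK mulnC addnC.
Qed.

Lemma bsum_bin2 a b i x :
  bsum a (fun p => bsum b (fun q => x (p + q)%N *+ 'C(p, i))) =
  bsum (a - i + b) (fun j => x (i + j)%N) *+ 'C(a, i).
Proof.
transitivity (bsum a (fun p => bsum b (fun q => x (p + q)%N) *+ 'C(p, i))).
  by apply: eq_bsum => p _; rewrite bsum_mulrn.
rewrite (bsum_bin a i (fun p => bsum b (fun q => x (p + q)%N))).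
rewrite -(bsum_add (a - i) b (fun j => x (i + j)%N)); congr (_ *+ _).
by apply: eq_bsum => p _; apply: eq_bsum => q _; rewrite addnA.
Qed.

Lemma bsum_lin a b (x y : nat -> nat -> T) s c :
  bsum a (fun p => bsum b (fun q => (x p q - y p q *~ s) *~ c)) =
  (bsum a (fun p => bsum b (x p)) - bsum b (fun q => bsum a (y^~ q)) *~ s) *~ c.
Proof.
rewrite (exchange_bsum b a (fun q p => y p q)) -(bsum_mulrz _ _ s) -bsumB.
rewrite -(bsum_mulrz _ _ c); apply: eq_bsum => p _.
by rewrite -(bsum_mulrz _ _ s) -bsumB -(bsum_mulrz _ _ c).
Qed.
End Bsum.

Section ZhuAlgebra.
Variables (F : fieldType) (V : voa F).
Local Notation vg := (vgr V).

Let Yb n : bilin (fun u v : V => vop u n v) := va_bilin (voa_va V) n.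
Let grP := voa_grading V.

(* Res_z Y(u, z) v (1 + z)^a z^n *)
Definition res_op (a : nat) (n : int) (u v : V) : V :=
  bsum a (fun i => vop u (n + i%:Z) v).

Lemma res_op_bilin a n : bilin (res_op a n).
Proof.
split=> [v c u u'|u c v v'] /=; rewrite /res_op /bsum scaler_sumr -big_split;
  apply: eq_bigr => i _ /=.
  by rewrite (bilinDl (Yb _)) (bilinZl (Yb _)) mulrnDl scalerMnr.
by rewrite (bilinDr (Yb _)) (bilinZr (Yb _)) mulrnDl scalerMnr.
Qed.
Let Rb := res_op_bilin.

Lemma bilin_bsumr (U W T : lmodType F) (f : U -> W -> T) : bilin f ->
  forall a u x, f u (bsum a x) = bsum a (fun i => f u (x i)).
Proof.
move=> fb a u x; rewrite (bilin_sumr fb); apply: eq_bigr => i _.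
exact: (bilinMnr fb).
Qed.

Inductive zhu_generator : V -> Prop :=
| zhu_residue (p : nat) (u v : V) (s t : nat) : vg p u -> (s <= t)%N ->
    zhu_generator (res_op (p + s) (- (2 + t)%:Z) u v)
| zhu_translation (u : V) : zhu_generator (Lop (-1) u + Lop 0 u).

Definition zhu_O : subspace V := Subspace (span_subspace zhu_generator).

(* u * v; the weight of the homogeneous component of degree p of u is p *)
Definition zhu_mul (u v : V) : V :=
  \sum_(p < hdeg grP u) res_op p (-1) (hcomp grP p u) v.

Lemma hcomp_sum_linear (T : lmodType F) (f : nat -> V -> T) :
  (forall p, linear (f p)) ->
  linear (fun u => \sum_(p < hdeg grP u) f p (hcomp grP p u)).
Proof.
move=> fL a u v.
have f0 p : f p 0 = 0.
  by have := fL p 1 0 0; rewrite !scale1r addr0 => /eqP; rewrite -subr_eq subrr => /eqP.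
have E x N : (hdeg grP x <= N)%N ->
  \sum_(p < hdeg grP x) f p (hcomp grP p x) = \sum_(p < N) f p (hcomp grP p x).
  move=> xN; rewrite (big_ord_widen N (fun p => f p (hcomp grP p x)) xN) big_mkcond.
  apply: eq_bigr => i _; case: ifP => // /negbT; rewrite -leqNgt => ge.
  by rewrite hcomp_ge.
pose N := maxn (hdeg grP (a *: u + v)) (maxn (hdeg grP u) (hdeg grP v)).
rewrite !(E _ N) ?leq_max ?leqnn ?orbT // scaler_sumr -big_split /=.
by apply: eq_bigr => p _; rewrite hcomp_linear fL.
Qed.

Lemma hcomp_sum_hom (T : lmodType F) (f : nat -> V -> T) p u :
  (forall p, linear (f p)) -> vg p u ->
  \sum_(q < hdeg grP u) f q (hcomp grP q u) = f p u.
Proof.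
move=> fL up.
have f0 q : f q 0 = 0.
  by have := fL q 1 0 0; rewrite !scale1r addr0 => /eqP; rewrite -subr_eq subrr => /eqP.
case: (ltnP p (hdeg grP u)) => pu.
  rewrite (bigD1 (Ordinal pu)) //= (hcomp_hom grP p up) eqxx big1 ?addr0 // => q qp.
  rewrite (hcomp_hom grP q up) ifN // ?f0 //; apply: contraNneq qp => qp.
have u0 : u = 0 by rewrite -(hcomp_ge pu) (hcomp_hom grP p up) eqxx.
rewrite big1 => [|q _]; first by rewrite u0 f0.
by rewrite (hcomp_hom grP q up); case: ifP => _; rewrite ?f0 // [X in f _ X]u0 f0.
Qed.

Lemma zhu_mul_bilin : bilin zhu_mul.
Proof.
split=> [v|u].
  apply: (hcomp_sum_linear (f := fun p u => res_op p (-1) u v)) => p.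
  exact: (Rb p (-1)).1.
move=> a v v'; rewrite /zhu_mul scaler_sumr -big_split; apply: eq_bigr => p _.
exact: (Rb p (-1)).2.
Qed.
Let Mb := zhu_mul_bilin.

Lemma zhu_mul_hom p u v : vg p u -> zhu_mul u v = res_op p (-1) u v.
Proof.
move=> up; apply: (hcomp_sum_hom (f := fun p u => res_op p (-1) u v)) up => q.
exact: (Rb q (-1)).1.
Qed.

Lemma zhu_mul_homz (p : nat) (c : int) u v : c = p%:Z -> grz vg c u ->
  zhu_mul u v = res_op p (-1) u v.
Proof. by move=> -> up; apply: zhu_mul_hom. Qed.

Let OP : is_subspace zhu_O := subspaceP zhu_O.

Lemma zhu_O_res (c : int) (a s t : nat) (n : int) u v : grz vg c u ->
  a%:Z = c + s%:Z -> n = - (2 + t)%:Z -> (s <= t)%N -> zhu_O (res_op a n u v).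
Proof.
case: c => p /= up ap nt st; last first.
  by rewrite up (bilin0l (Rb _ _)); apply: span_zero.
by apply: span_gen; rewrite nt; move: ap; rewrite -PoszD => -[->]; constructor.
Qed.

Lemma zhu_translationE u :
  Lop (-1) u + Lop 0 u = \sum_(p < hdeg grP u) res_op p (-2) (hcomp grP p u) (vacuum V).
Proof.
have VP := voa_va V.
rewrite {1 2}(hcomp_sum grP u) /Lop !(bilin_sumr (Yb _)) -big_split.
apply: eq_bigr => p _ /=; set x := hcomp grP p u.
have xp : vg p x by apply: hcomp_gr.
rewrite /res_op (bsum_widen (N := p.+2) _ (ltnW _)) // !big_ord_recl big1 ?addr0.
  have D : vop (conformal V) 0 x = vop x (-2) (vacuum V).
    by rewrite -(va_creation VP (vop _ 0 x)) voa_derivative opprK mulr1z.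
  transitivity (vop x (-2) (vacuum V) *+ 'C(p, 0) + vop x (-1) (vacuum V) *+ 'C(p, 1)).
    by rewrite bin0 bin1 (va_creation VP) -D -(voa_weight xp).
  by [].
move=> i _; have -> : -2 + (lift ord0 (lift ord0 i))%:Z = i%:Z.
  by rewrite !lift0; lia.
by rewrite (va_regular VP) mul0rn.
Qed.

Lemma zhu_O_ind (P : V -> Prop) : is_subspace P ->
  (forall p q u v s t, vg p u -> vg q v -> (s <= t)%N ->
     P (res_op (p + s) (- (2 + t)%:Z) u v)) ->
  forall x, zhu_O x -> P x.
Proof.
move=> PP PR; apply: span_min => // x [p u v s t up st|u].
  rewrite (hcomp_sum grP v) (bilin_sumr (Rb _ _)).
  by apply: is_subspace_sum => // q _; apply: PR up (hcomp_gr grP _ _) st.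
rewrite zhu_translationE; apply: is_subspace_sum => // p _.
rewrite -[in res_op p](addn0 p).
exact: PR (hcomp_gr grP _ _) (voa_vacuum V) (leqnn 0).
Qed.

Section Identities.
Variables (u v w : V).
Let J := va_jacobi (voa_va V).

Lemma res_op_iterate (a b : nat) (n k : int) : eventually (fun N =>
  \sum_(i < a.+1) res_op (a - i + b) k (vop u (n + i%:Z) v) w *+ 'C(a, i) =
  \sum_(i < N) (res_op a (n - i%:Z) u (res_op b (k + i%:Z) v w)
      - res_op b (n + k - i%:Z) v (res_op a i%:Z u w) *~ (-1) ^ n)
    *~ ((-1) ^+ i * binz n i)).
Proof.
have H1 := eventually_bounded a.+1 (fun p => eventually_bounded b.+1
  (fun q => J u v w p%:Z n (k + q%:Z))).
have H2 : eventually (fun N => (a < N)%N) by exists a.+1.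
apply: eventually_and_mono H2 H1 => N aN JN.
set X := fun i r => vop (vop u (n + i%:Z) v) (r%:Z + k - i%:Z) w.
have E1 : \sum_(i < a.+1) res_op (a - i + b) k (vop u (n + i%:Z) v) w *+ 'C(a, i) =
    bsum a (fun p => bsum b (fun q =>
      jacobi_iterate vop vop u v w p%:Z n (k + q%:Z) N)).
  transitivity (\sum_(i < N) bsum a (fun p => bsum b (fun q =>
      X i (p + q)%N *+ 'C(p, i)))).
    rewrite -/(bsum a (fun i => res_op (a - i + b) k (vop u (n + i%:Z) v) w)).
    rewrite (bsum_widen _ aN); apply: eq_bigr => i _; rewrite bsum_bin2.
    congr (_ *+ _); apply: eq_bsum => j _; rewrite /X PoszD.
    by congr (vop _ _ _); rewrite -!addrA [RHS]addrC -!addrA addNr addr0 addrC.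
  rewrite -bsum_sum; apply: eq_bsum => p _; rewrite -bsum_sum; apply: eq_bsum => q _.
  apply: eq_bigr => i _; rewrite /X PoszD -pmulrn.
  by congr (vop _ _ _ *+ _); rewrite -!addrA; congr (_ + _); rewrite addrCA.
rewrite E1 /=.
transitivity (bsum a (fun p => bsum b (fun q =>
      jacobi_commutator vop u v w p%:Z n (k + q%:Z) N))).
  by apply: eq_bsum => p pa; apply: eq_bsum => q qb; rewrite JN.
transitivity (\sum_(i < N) bsum a (fun p => bsum b (fun q =>
   (vop u (p%:Z + n - i%:Z) (vop v (k + q%:Z + i%:Z) w)
      - vop v (n + (k + q%:Z) - i%:Z) (vop u (p%:Z + i%:Z) w) *~ (-1) ^ n)
    *~ ((-1) ^+ i * binz n i)))).
  by rewrite -bsum_sum; apply: eq_bsum => p _; rewrite -bsum_sum.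
apply: eq_bigr => i _.
rewrite bsum_lin; congr ((_ - _ *~ _) *~ _); apply: eq_bsum => p _.
  rewrite (bilin_bsumr (Yb _)); apply: eq_bsum => q _.
  by congr (vop _ _ (vop _ _ _)); lia.
rewrite (bilin_bsumr (Yb _)); apply: eq_bsum => q _.
by congr (vop _ _ (vop _ _ _)); lia.
Qed.

Lemma res_op_commutator (a b : nat) (k : int) : eventually (fun N =>
  res_op a (-1) u (res_op b k v w) - res_op b k v (res_op a (-1) u w) =
  \sum_(l < N) \sum_(i < l.+1)
    res_op (a - i + b) (k - 1 - (l%:Z - i%:Z)) (vop u l%:Z v) w
      *~ ((-1) ^+ (l - i) * 'C(a, i)%:Z)).
Proof.
have H1 := eventually_bounded a.+1 (fun p => eventually_bounded b.+1
  (fun q => J u v w (p%:Z - 1) 0 (k + q%:Z))).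
have H2 : eventually (fun N => (0 < N)%N) by exists 1%N.
apply: eventually_and_mono H2 H1 => N N0 JN.
set X := fun l r => vop (vop u l%:Z v) (r%:Z - 1 + k - l%:Z) w.
transitivity (bsum a (fun p => bsum b (fun q =>
      jacobi_commutator vop u v w (p%:Z - 1) 0 (k + q%:Z) N))).
  transitivity (bsum a (fun p => bsum b (fun q =>
    (vop u (p%:Z - 1) (vop v (k + q%:Z) w) -
     vop v (k + q%:Z) (vop u (p%:Z - 1) w) *~ 1) *~ 1))).
    rewrite bsum_lin !mulr1z; congr (_ - _); apply: eq_bsum => p _.
      rewrite (bilin_bsumr (Yb _)); apply: eq_bsum => q _.
      by congr (vop _ _ (vop _ _ _)); lia.
    rewrite (bilin_bsumr (Yb _)); apply: eq_bsum => q _.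
    by congr (vop _ _ (vop _ _ _)); lia.
  apply: eq_bsum => p _; apply: eq_bsum => q _.
  case: N N0 {JN} => // N _; rewrite /jacobi_commutator big_ord_recl big1 ?addr0.
    rewrite expr0 mul1r [binz 0 _]/=.
    by congr ((vop _ _ (vop _ _ _) - vop _ _ (vop _ _ _) *~ _) *~ _); lia.
  by move=> i _; rewrite [binz 0 _]/= bin0n /= mulr0 mulr0z.
transitivity (bsum a (fun p => bsum b (fun q =>
      jacobi_iterate vop vop u v w (p%:Z - 1) 0 (k + q%:Z) N))).
  by apply: eq_bsum => p pa; apply: eq_bsum => q qb; rewrite JN.
transitivity (\sum_(l < N) bsum a (fun p => bsum b (fun q =>
    \sum_(i < l.+1) X l (p + q)%N *+ 'C(p, i) *~ ((-1) ^+ (l - i))))).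
  rewrite -bsum_sum; apply: eq_bsum => p _; rewrite -bsum_sum; apply: eq_bsum => q _.
  apply: eq_bigr => l _; rewrite binz_pred mulrz_sumr; apply: eq_bigr => i _.
  rewrite mulrC mulrzA -pmulrn /X; congr (vop (vop _ _ _) _ _ *+ _ *~ _); lia.
apply: eq_bigr => l _.
transitivity (\sum_(i < l.+1) bsum a (fun p => bsum b (fun q =>
    X l (p + q)%N *+ 'C(p, i))) *~ ((-1) ^+ (l - i))).
  under [RHS]eq_bigr => i _ do rewrite -bsum_mulrz.
  rewrite -bsum_sum; apply: eq_bsum => p _.
  under [RHS]eq_bigr => i _ do rewrite -bsum_mulrz.
  by rewrite -bsum_sum.
apply: eq_bigr => i _; rewrite bsum_bin2 mulrC mulrzA -pmulrn.
congr (_ *+ _ *~ _); apply: eq_bsum => j _; rewrite /X.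
by congr (vop _ _ _); lia.
Qed.
End Identities.

Lemma zhu_mul_zhu_O u v : zhu_O v -> zhu_O (zhu_mul u v).
Proof.
move=> Ov; apply: is_subspace_sum => // p _.
have := hcomp_gr grP p u; move: (nat_of_ord p) => {}p.
move: (hcomp grP p u) => {}u up; move: v Ov; apply: zhu_O_ind.
  split=> [|a v v' Ov Ov']; first by rewrite (bilin0r (Rb _ _)); case: OP.
  by rewrite (bilinDr (Rb _ _)) (bilinZr (Rb _ _)); apply: OP.2.
move=> q r v w s t vq wr st.
have [N /(_ N (leqnn N)) E] := res_op_commutator u v w p (q + s) (- (2 + t)%:Z).
rewrite -[res_op p _ _ _](subrK (res_op (q + s) (- (2 + t)%:Z) v (res_op p (-1) u w))).
rewrite {}E; apply: is_subspaceD => //; last by apply: span_gen; constructor.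
apply: is_subspace_sum => // l _; apply: is_subspace_sum => // i _.
case: (leqP i p) => ip; last by rewrite bin_small // mulr0 mulr0z; case: OP.
apply: is_subspaceMz => //.
have il : (i <= l)%N by rewrite -ltnS.
apply: (zhu_O_res (c := p%:Z + q%:Z - l%:Z - 1) (s := (s + l.+1 - i)%N)
  (t := (t + l.+1 - i)%N)); [exact: voa_degree|lia|lia|lia].
Qed.

Lemma zhu_O_zhu_mul u v : zhu_O u -> zhu_O (zhu_mul u v).
Proof.
move: u; apply: zhu_O_ind.
  split=> [|a u u' Ou Ou']; first by rewrite (bilin0l Mb); case: OP.
  by rewrite (bilinDl Mb) (bilinZl Mb); apply: OP.2.
move=> p q u x s t up xq st.
have [N /(_ N (leqnn N)) E] :=
  res_op_iterate u x v (p + s) (q + 1 + t - s) (- (2 + t)%:Z) (-1).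
have -> : zhu_mul (res_op (p + s) (- (2 + t)%:Z) u x) v =
  \sum_(i < (p + s).+1) res_op (p + s - i + (q + 1 + t - s)) (-1)
     (vop u (- (2 + t)%:Z + i%:Z) x) v *+ 'C(p + s, i).
  rewrite {1}/res_op /bsum (bilin_suml Mb); apply: eq_bigr => i _.
  rewrite (bilinMnl Mb); congr (_ *+ _).
  have ip : (i <= p + s)%N by rewrite -ltnS.
  apply: (zhu_mul_homz (c := p%:Z + q%:Z - (- (2 + t)%:Z + i%:Z) - 1)); first lia.
  exact: voa_degree.
rewrite {}E; apply: is_subspace_sum => // i _; apply: is_subspaceMz => //.
apply: is_subspaceB => //; last apply: is_subspaceMz => //.
  by apply: (zhu_O_res (c := p) (s := s) (t := (t + i)%N)) => //; lia.
by apply: (zhu_O_res (c := q) (s := (1 + t - s)%N) (t := (t + 1 + i)%N)) => //; lia.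
Qed.

Lemma zhu_mulA u v w :
  zhu_O (zhu_mul u (zhu_mul v w) - zhu_mul (zhu_mul u v) w).
Proof.
pose D u v := zhu_mul u (zhu_mul v w) - zhu_mul (zhu_mul u v) w.
have Db : bilin D.
  split=> [y a x x'|x a y y'] /=; rewrite /D.
    rewrite !(bilinDl Mb) !(bilinZl Mb).
    by rewrite opprD addrACA scalerBr.
  rewrite !(bilinDl Mb) !(bilinDr Mb) !(bilinZl Mb) !(bilinZr Mb).
  by rewrite (bilinDl Mb) (bilinZl Mb) opprD addrACA scalerBr.
rewrite -/(D u v) (hcomp_sum grP u) (bilin_suml Db).
apply: is_subspace_sum => // p _; have := hcomp_gr grP p u.
move: (nat_of_ord p) => {}p; move: (hcomp grP p u) => {}u up.
rewrite (hcomp_sum grP v) (bilin_sumr Db).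
apply: is_subspace_sum => // q _; have := hcomp_gr grP q v.
move: (nat_of_ord q) => {}q; move: (hcomp grP q v) => {}v vq.
have [N0 /(_ N0.+1 (leqnSn N0)) E] := res_op_iterate u v w p q (-1) (-1).
have E1 : zhu_mul (zhu_mul u v) w =
  \sum_(i < p.+1) res_op (p - i + q) (-1) (vop u (-1 + i%:Z) v) w *+ 'C(p, i).
  rewrite (zhu_mul_hom v up) {1}/res_op /bsum (bilin_suml Mb).
  apply: eq_bigr => i _; rewrite (bilinMnl Mb); congr (_ *+ _).
  have ip : (i <= p)%N by rewrite -ltnS.
  apply: (zhu_mul_homz (c := p%:Z + q%:Z - (-1 + i%:Z) - 1)); first lia.
  exact: voa_degree.
rewrite /D {}E1 {}E big_ord_recl (zhu_mul_hom w vq) (zhu_mul_hom _ up).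
rewrite -[X in _ - (X + _)]/(res_op p (-1) u (res_op q (-1) v w) -
  res_op q (-2) v (res_op p 0 u w) *~ (-1) ^ (-1)).
rewrite opprD addrA opprB addrCA subrr addr0.
apply: is_subspaceB => //.
  apply: is_subspaceMz => //.
  by apply: (zhu_O_res (c := q) (s := 0%N) (t := 0%N)) => //; lia.
apply: is_subspace_sum => // i _; apply: is_subspaceMz => //.
apply: is_subspaceB => //; last apply: is_subspaceMz => //.
  by apply: (zhu_O_res (c := p) (s := 0%N) (t := i)) => //; lia.
by apply: (zhu_O_res (c := q) (s := 0%N) (t := i.+1)) => //; lia.
Qed.

Lemma zhu_mul1l v : zhu_mul (vacuum V) v = v.
Proof.
rewrite (zhu_mul_hom v (voa_vacuum V)) /res_op /bsum big_ord1 bin0 addr0.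
by rewrite (va_vacuum (voa_va V)).
Qed.

Lemma zhu_mul1r v : zhu_mul v (vacuum V) = v.
Proof.
have VP := voa_va V.
rewrite {2}(hcomp_sum grP v); apply: eq_bigr => p _.
rewrite /res_op /bsum big_ord_recl bin0 addr0 (va_creation VP) big1 ?addr0 // => i _.
have -> : -1 + (lift ord0 i)%:Z = i%:Z by rewrite lift0; lia.
by rewrite (va_regular VP) mul0rn.
Qed.

Local Notation AV := (quot_space zhu_O).

Definition zhu_amul (x y : AV) : AV :=
  quot_class zhu_O (zhu_mul (quot_repr x) (quot_repr y)).

Lemma zhu_amulE u v : zhu_amul (quot_class zhu_O u) (quot_class zhu_O v) =
  quot_class zhu_O (zhu_mul u v).
Proof.
apply/quot_classP; set u' := quot_repr _; set v' := quot_repr _.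
have -> : zhu_mul u' v' - zhu_mul u v = zhu_mul (u' - u) v' + zhu_mul u (v' - v).
  rewrite (bilinDl Mb) (bilinNl Mb) (bilinDr Mb) (bilinNr Mb).
  by rewrite addrA subrK.
apply: is_subspaceD => //.
  exact/zhu_O_zhu_mul/quot_reprP.
exact/zhu_mul_zhu_O/quot_reprP.
Qed.

Lemma zhu_amul_bilin : bilin zhu_amul.
Proof.
split=> [y a x x'|x a y y'] /=.
  rewrite -(quot_reprK x) -(quot_reprK x') -(quot_reprK y) -quot_class_linear.
  by rewrite !zhu_amulE (zhu_mul_bilin).1 quot_class_linear.
rewrite -(quot_reprK x) -(quot_reprK y') -(quot_reprK y) -quot_class_linear.
by rewrite !zhu_amulE (zhu_mul_bilin).2 quot_class_linear.
Qed.

Lemma zhu_amulA : associative zhu_amul.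
Proof.
move=> x y z; rewrite -(quot_reprK x) -(quot_reprK y) -(quot_reprK z) !zhu_amulE.
exact/quot_classP/zhu_mulA.
Qed.

Lemma zhu_amul1l : left_id (quot_class zhu_O (vacuum V)) zhu_amul.
Proof. by move=> x; rewrite -(quot_reprK x) zhu_amulE zhu_mul1l. Qed.

Lemma zhu_amul1r : right_id (quot_class zhu_O (vacuum V)) zhu_amul.
Proof. by move=> x; rewrite -(quot_reprK x) zhu_amulE zhu_mul1r. Qed.

Definition zhu_algebra : assoc_algebra F := {|
  alg_space := AV;
  amul := zhu_amul;
  aone := quot_class zhu_O (vacuum V);
  amul_bilin := zhu_amul_bilin;
  amulA := zhu_amulA;
  amul1l := zhu_amul1l;
  amul1r := zhu_amul1r |}.

Variable M : admissible_module V.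
Let MYb n : bilin (fun (u : V) (w : M) => mop u n w) := wm_bilin (adm_weak M) n.
Let mgP := adm_grading M.

Definition top_space : subspace M := Subspace (grading_sub mgP 0).

(* The action of u on M(0): u_(wt u - 1) for homogeneous u *)
Definition zero_mode (u : V) (w : M) : M :=
  \sum_(p < hdeg grP u) mop (hcomp grP p u) (p%:Z - 1) w.

Lemma zero_mode_bilin : bilin zero_mode.
Proof.
split=> [w|u].
  apply: (hcomp_sum_linear (f := fun p u => mop u (p%:Z - 1) w)) => p.
  exact: (MYb _).1.
move=> a w w'; rewrite /zero_mode scaler_sumr -big_split; apply: eq_bigr => p _.
exact: (MYb _).2.
Qed.
Let Zb := zero_mode_bilin.

Lemma zero_mode_hom p u w : vg p u -> zero_mode u w = mop u (p%:Z - 1) w.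
Proof.
move=> up; apply: (hcomp_sum_hom (f := fun p u => mop u (p%:Z - 1) w)) up => q.
exact: (MYb _).1.
Qed.

Lemma zero_mode_homz (c n : int) u w : n = c - 1 -> grz vg c u ->
  zero_mode u w = mop u n w.
Proof.
move=> ->; case: c => p /=; first exact: zero_mode_hom.
by move=> ->; rewrite (bilin0l Zb) (bilin0l (MYb _)).
Qed.

Lemma top_annihilate p n u w : vg p u -> top_space w -> p%:Z <= n -> mop u n w = 0.
Proof.
move=> up w0 pn; have := adm_degree n up w0.
by have [k ->] : exists k, p%:Z + 0%:Z - n - 1 = Negz k by exists (`|n - p%:Z|)%N; lia.
Qed.

Lemma zero_mode_top u w : top_space w -> top_space (zero_mode u w).
Proof.
have TP := subspaceP top_space.
move=> w0; apply: is_subspace_sum => // p _.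
have := adm_degree (p%:Z - 1) (hcomp_gr grP p u) w0.
by have -> : p%:Z + 0%:Z - (p%:Z - 1) - 1 = 0%:Z by lia.
Qed.

Lemma zero_mode_zhu_O u w : top_space w -> zhu_O u -> zero_mode u w = 0.
Proof.
move=> w0; move: u; apply: zhu_O_ind.
  split=> [|a u u' H H']; first by rewrite (bilin0l Zb).
  by rewrite (bilinDl Zb) (bilinZl Zb) H H' scaler0 addr0.
move=> p q u v s t up vq st.
have [N0 /(_ (maxn N0 (p + s).+1) (leq_maxl _ _))] :=
  wm_jacobi (adm_weak M) u v w (p + s)%N (- (2 + t)%:Z) (q%:Z + t%:Z - s%:Z).
set N := maxn _ _; have aN : (p + s < N)%N by rewrite leq_maxr.
move=> E; transitivity (jacobi_iterate vop mop u v w (p + s)%N (- (2 + t)%:Z)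
   (q%:Z + t%:Z - s%:Z) N).
  rewrite /res_op (bsum_widen _ aN) (bilin_suml Zb); apply: eq_bigr => i _.
  rewrite (bilinMnl Zb) [binz _ _]/= -pmulrn; congr (_ *+ _).
  apply: (zero_mode_homz (c := p%:Z + q%:Z - (- (2 + t)%:Z + i%:Z) - 1)); first lia.
  exact: voa_degree.
rewrite -{}E; apply: big1 => i _.
rewrite (top_annihilate vq w0) ?(top_annihilate up w0) //; try lia.
by rewrite !(bilin0r (MYb _)) mul0rz subr0 mul0rz.
Qed.

Lemma zero_mode_mul u v w : top_space w ->
  zero_mode (zhu_mul u v) w = zero_mode u (zero_mode v w).
Proof.
move=> w0; pose D u v := zero_mode (zhu_mul u v) w - zero_mode u (zero_mode v w).
suff : D u v = 0 by move/eqP; rewrite subr_eq0 => /eqP.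
have Db : bilin D.
  split=> [y a x x'|x a y y'] /=; rewrite /D.
    rewrite (bilinDl Mb) (bilinZl Mb) !(bilinDl Zb) !(bilinZl Zb).
    by rewrite opprD addrACA scalerBr.
  rewrite (bilinDr Mb) (bilinZr Mb) !(bilinDl Zb) !(bilinZl Zb).
  by rewrite (bilinDr Zb) (bilinZr Zb) opprD addrACA scalerBr.
rewrite (hcomp_sum grP u) (bilin_suml Db) big1 // => p _.
have := hcomp_gr grP p u; move: (nat_of_ord p) => {}p; move: (hcomp grP p u) => {}u up.
rewrite (hcomp_sum grP v) (bilin_sumr Db) big1 // => q _.
have := hcomp_gr grP q v; move: (nat_of_ord q) => {}q; move: (hcomp grP q v) => {}v vq.
have [N0 /(_ (maxn N0 p).+1 (leqW (leq_maxl _ _)))] :=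
  wm_jacobi (adm_weak M) u v w p (-1) (q%:Z - 1).
set N := maxn _ _; have aN : (p < N.+1)%N by rewrite ltnS leq_maxr.
move=> E.
have E1 : zero_mode (zhu_mul u v) w =
  jacobi_iterate vop mop u v w p (-1) (q%:Z - 1) N.+1.
  rewrite (zhu_mul_hom v up) /res_op (bsum_widen _ aN) (bilin_suml Zb).
  apply: eq_bigr => i _.
  rewrite (bilinMnl Zb) [binz _ _]/= -pmulrn; congr (_ *+ _).
  apply: (zero_mode_homz (c := p%:Z + q%:Z - (-1 + i%:Z) - 1)); first lia.
  exact: voa_degree.
rewrite /D {}E1 -{}E (zero_mode_hom w vq) (zero_mode_hom _ up).
rewrite /jacobi_commutator big_ord_recl big1 => [|i _].
  rewrite (top_annihilate up w0) ?(bilin0r (MYb _)); last lia.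
  by rewrite mul0rz !subr0 /= !addr0 mulr1 mulr1z subrr.
rewrite (top_annihilate vq w0) ?(top_annihilate up w0) ?lift0 //; try lia.
by rewrite !(bilin0r (MYb _)) mul0rz subr0 mul0rz.
Qed.

Definition zhu_act (x : zhu_algebra) (w : sub_space top_space) : sub_space top_space :=
  sub_space_mk (zero_mode_top (quot_repr (x : AV)) (sub_spaceP w)).

Lemma zhu_actE u w : val (zhu_act (quot_class zhu_O u) w) = zero_mode u (val w).
Proof.
rewrite /=; apply/eqP; rewrite -subr_eq0 -(bilinNl Zb) -(bilinDl Zb); apply/eqP.
by apply: zero_mode_zhu_O (sub_spaceP w) _; apply: quot_reprP.
Qed.

Lemma zhu_act_bilin : bilin zhu_act.
Proof.
split=> [w a x y|x a w w'] /=; apply: val_inj.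
  rewrite -(quot_reprK (x : AV)) -(quot_reprK (y : AV)) -quot_class_linear.
  by rewrite sub_space_valP !zhu_actE; apply: Zb.1.
by rewrite -(quot_reprK (x : AV)) sub_space_valP !zhu_actE sub_space_valP; apply: Zb.2.
Qed.

Lemma zhu_act1 w : zhu_act (aone zhu_algebra) w = w.
Proof.
apply: val_inj; rewrite zhu_actE (zero_mode_hom _ (voa_vacuum V)).
by rewrite (wm_vacuum (adm_weak M)).
Qed.

Lemma zhu_actM x y w : zhu_act (amul x y) w = zhu_act x (zhu_act y w).
Proof.
apply: val_inj; rewrite -(quot_reprK (x : AV)) -(quot_reprK (y : AV)).
rewrite [amul _ _]zhu_amulE !zhu_actE; apply: zero_mode_mul; exact: sub_spaceP.
Qed.

Definition zhu_top : alg_module zhu_algebra := {|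
  amod_space := sub_space top_space;
  act := zhu_act;
  act_bilin := zhu_act_bilin;
  act1 := zhu_act1;
  actM := zhu_actM |}.

End ZhuAlgebra.

(* Main.v *)
Require Import Defs.
From HB Require Import structures.
From mathcomp Require Import all_boot all_algebra.
From mathcomp Require Import boolp classical_sets functions zify.

(** An element x of K (x) M is determined by its contractions (phi (x) 1) x along
    the F-linear functionals phi of K, and contraction commutes with the modes of V.
    In an irreducible M, a homogeneous vector of degree t killed by all the modes
    u_(wt u + t - 1) is zero, since the submodule it generates misses M(0).  By
    contraction the same holds in M^K, so nonzero graded submodules of M^K meet
    M(0)^K; as the submodule generated by a zero-mode stable subspace of the top
    level meets the top level in that subspace, M^K is irreducible if and only if
    M(0)^K is simple.

    If End(M(0)) = F, an element of a submodule of M(0)^K with the fewest tensors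
    is a pure tensor, and M(0)^K is simple.  Conversely an endomorphism d of a simple
    module S lies in the field K of the endomorphisms commuting with everything that
    commutes with d; if S^K is simple then the evaluation K (x) S -> S is injective,
    and d (x) s - 1 (x) d s = 0 forces d to be a scalar.  Finally an endomorphism of
    M preserves M(0), and is determined by its restriction. *)

Set Implicit Arguments.
Unset Strict Implicit.
Unset Printing Implicit Defensive.

Import GRing.Theory.
Local Open Scope ring_scope.

(** * Functionals and contractions of tensors *)

(** By Zorn's lemma some subspace [A] is maximal among those containing [U] and missing [v]. The
    line through [v] is a complement of [A], and [phi] reads the coordinate along [v]. *)
Lemma separating_functional (F : fieldType) (V : lmodType F) (U : V -> Prop) (v : V) :
  is_subspace U -> ~ U v ->
  exists phi : V -> F, [/\ scalar phi, phi v = 1 & forall x, U x -> phi x = 0].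
Proof.
move=> [U0 Ulin] Uv.
(* Only a nonempty [A] has to contain [U], so that the union of the empty chain satisfies [P]. *)
pose P (A : set V) := [/\ (exists x, A x) -> forall x, U x -> A x,
  forall a x y, A x -> A y -> A (a *: x + y) & ~ A v].
have [C CP Ctot|A [[AU Alin Av] Amax]] := @Zorn_bigcup V P.
  split=> [[x [X CX Xx]] y Uy|a x y [X CX Xx] [Y CY Yy]|[X CX Xv]].
  - by exists X => //; have [XU _ _] := CP _ CX; apply: XU Uy; exists x.
  - have [XY|YX] := Ctot _ _ CX CY.
      by exists Y => //; have [_ + _] := CP _ CY; apply=> //; apply: XY.
    by exists X => //; have [_ + _] := CP _ CX; apply=> //; apply: YX.
  - by have [_ _ nXv] := CP _ CX; apply: nXv.
have A0 : A 0.
  apply: contrapT => A0; apply: (Amax U); last by split.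
  by split=> [x Ax|UA]; [case: A0; apply: AU U0; exists x|apply/A0/UA].
have {}AU := AU (ex_intro _ _ A0).
have AZ a x : A x -> A (a *: x) by move=> Ax; rewrite -[_ *: _]addr0; apply: Alin.
(* Otherwise [A] plus the line through [x] would be a larger subspace missing [v]. *)
have dec x : exists c, A (x - c *: v).
  apply: contrapT => nx; pose B y := exists2 c, exists2 z, A z & y = c *: x + z & True.
  apply: (Amax B); last split=> [_ y Uy|a _ _ [c [z Az ->] _] [e [t At ->] _]|].
  - split=> [y Ay|BA]; first by exists 0 => //; exists y; rewrite // scale0r add0r.
    apply: nx; exists 0; rewrite scale0r subr0; apply: BA.
    by exists 1 => //; exists 0; rewrite // scale1r addr0.
  - by exists 0 => //; exists y; rewrite ?scale0r ?add0r //; apply: AU.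
  - exists (a * c + e) => //; exists (a *: z + t); first exact: Alin.
    by rewrite scalerDr scalerA scalerDl addrACA.
  move=> [c [z Az vE] _]; have [c0|c0] := eqVneq c 0.
    by apply: Av; rewrite vE c0 scale0r add0r.
  apply: nx; exists c^-1; rewrite vE scalerDr scalerA mulVf // scale1r opprD addNKr.
  by rewrite -scaleNr; apply: AZ.
have uniq x c e : A (x - c *: v) -> A (x - e *: v) -> c = e.
  move=> Ac Ae; apply: contrapT => /eqP; rewrite -subr_eq0 => ce; apply: Av.
  rewrite -[v]scale1r -(mulVf ce) -scalerA; apply: AZ.
  have -> : (c - e) *: v = -1 *: (x - c *: v) + (x - e *: v); last exact: Alin.
  by rewrite scaleN1r opprB addrA subrK scalerBl.
pose phi x := sval (cid (dec x)).
have phiP x : A (x - phi x *: v) by rewrite /phi; case: cid.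
exists phi; split=> [a x y||x Ux].
- apply: (uniq (a *: x + y)) => //.
  rewrite scalerDl opprD addrACA -scalerA -scalerBr.
  exact: Alin.
- by apply: (uniq v) => //; rewrite scale1r subrr.
- by apply: (uniq x) => //; rewrite scale0r subr0; apply: AU.
Qed.

Lemma tens_zerol (F K : fieldType) (iota : {rmorphism F -> K}) (V : lmodType F)
  (v : V) : tens iota 0 v = 0.
Proof. by apply: (addIr (tens iota 0 v)); rewrite -tens_addl !add0r. Qed.

Section TensorLift.
Variables (F K : fieldType) (iota : {rmorphism F -> K}) (V : lmodType F).
Variables (W : zmodType) (f : K -> V -> W).

Definition balanced : Prop :=
  [/\ forall a b v, f (a + b) v = f a v + f b v,
      forall a v w, f a (v + w) = f a v + f a w
    & forall a c v, f (a * iota c) v = f a (c *: v)].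

(** Unlike for [ext_lift], the target is any abelian group: contractions and evaluations take values
    in spaces over [F], not over [K]. *)
Definition tens_lift (x : ext_space iota V) : W :=
  \sum_(p <- ext_repr x) f p.1 p.2.

Hypothesis fP : balanced.

Lemma tens_lift_class s : tens_lift (ext_class iota s) = \sum_(p <- s) f p.1 p.2.
Proof.
have [fDl fDr fZ] := fP; have f0 v : f 0 v = 0.
  by apply: (addIr (f 0 v)); rewrite -fDl !add0r.
have := ext_reprP iota s; rewrite /tens_lift; move: (ext_repr _) => t.
elim=> {s t} [//|//|s t r _ -> _ -> //|s t s' t' _ H1 _ H2|s t|v|a b v|a v w|a c v].
- by rewrite !big_cat /= H1 H2.
- by rewrite !big_cat /= addrC.
- by rewrite big_seq1 big_nil f0.
- by rewrite big_seq1 big_cons big_seq1 /= fDl.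
- by rewrite big_seq1 big_cons big_seq1 /= fDr.
- by rewrite !big_seq1 /= fZ.
Qed.

Lemma tens_lift_tens a v : tens_lift (tens iota a v) = f a v.
Proof. by rewrite tens_lift_class big_seq1. Qed.

Lemma tens_liftD x y : tens_lift (x + y) = tens_lift x + tens_lift y.
Proof.
rewrite -(ext_reprK x) -(ext_reprK y) [_ + ext_class _ _]ext_addE.
by rewrite !tens_lift_class big_cat.
Qed.

Lemma tens_lift0 : tens_lift 0 = 0.
Proof. by apply: (addIr (tens_lift 0)); rewrite -tens_liftD !add0r. Qed.

End TensorLift.

(** The alias lets [K] carry a structure of vector space over [F] that depends on [iota]. *)
Definition restricted (F K : fieldType) (iota : {rmorphism F -> K}) : Type := K.

Section Restricted.
Variables (F K : fieldType) (iota : {rmorphism F -> K}).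
Local Notation KF := (restricted iota).
HB.instance Definition _ := GRing.Zmodule.on KF.
Let scale (c : F) (k : KF) : KF := iota c * (k : K).

Let scaleA a b k : scale a (scale b k) = scale (a * b) k.
Proof. by rewrite /scale rmorphM mulrA. Qed.
Let scale1 : left_id 1 scale.
Proof. by move=> k; rewrite /scale rmorph1 mul1r. Qed.
Let scaleDr : right_distributive scale +%R.
Proof. by move=> a x y; apply: mulrDr. Qed.
Let scaleDl k : {morph scale^~ k : a b / a + b}.
Proof. by move=> a b; rewrite /scale rmorphD mulrDl. Qed.
HB.instance Definition _ :=
  GRing.Zmodule_isLmodule.Build F KF scaleA scale1 scaleDr scaleDl.

Lemma restricted_scaleE (c : F) (k : KF) : c *: k = iota c * (k : K).
Proof. by []. Qed.
End Restricted.

Section Contraction.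
Variables (F K : fieldType) (iota : {rmorphism F -> K}).
Local Notation KF := (restricted iota).

Definition contract (V : lmodType F) (phi : KF -> F) (x : ext_space iota V) : V :=
  tens_lift (fun a v => phi a *: v) x.

Section Linear.
Variables (V : lmodType F) (phi : KF -> F).
Hypothesis phiP : scalar phi.

Let phiD a b : phi (a + b) = phi a + phi b.
Proof. by have := phiP 1 a b; rewrite scale1r => ->; congr (_ + _); apply: mul1r. Qed.

Let phi0 : phi 0 = 0.
Proof. by apply: (addIr (phi 0)); rewrite -phiD !add0r. Qed.

Let phiZ c a : phi (iota c * a) = c * phi a.
Proof. by have := phiP c a 0; rewrite !addr0 phi0 addr0. Qed.

Lemma contract_balanced : balanced iota (fun (a : K) (v : V) => phi a *: v).
Proof.
split=> [a b v|a v w|a c v]; first by rewrite phiD scalerDl.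
  exact: scalerDr.
by rewrite mulrC phiZ scalerA mulrC.
Qed.

Lemma contractD (x y : ext_space iota V) :
  contract phi (x + y) = contract phi x + contract phi y.
Proof. exact: tens_liftD contract_balanced x y. Qed.

Lemma contract0 : contract phi (0 : ext_space iota V) = 0.
Proof. exact: tens_lift0 contract_balanced. Qed.

Lemma contract_class (s : seq (K * V)) :
  contract phi (ext_class iota s) = \sum_(p <- s) phi p.1 *: p.2.
Proof. exact: tens_lift_class contract_balanced s. Qed.

Lemma contract_tens a (v : V) : contract phi (tens iota a v) = phi a *: v.
Proof. exact: tens_lift_tens contract_balanced a v. Qed.
End Linear.

Variable V : lmodType F.

Lemma contract_op (U W : lmodType F) (f : U -> V -> W) (phi : KF -> F) u x :
  bilin f -> scalar phi ->
  contract phi (ext_op f (tens iota 1 u) x) = f u (contract phi x).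
Proof.
move=> fb phiP; have eb := ext_op_bilin iota fb.
elim/ext_ind: x => [|a v x IH].
  by rewrite (bilin0r eb) !contract0 // (bilin0r fb).
rewrite (bilinDr eb) !contractD // IH (bilinDr fb) ext_op_tens // mul1r.
by rewrite !contract_tens // (bilinZr fb).
Qed.

Lemma contract_sub (U : V -> Prop) x : is_subspace U -> ext_sub (iota := iota) U x ->
  forall phi : KF -> F, scalar phi -> U (contract phi x).
Proof.
move=> UP; move: x; apply: ext_sub_min => [|a v Uv phi phiP]; last first.
  by rewrite contract_tens //; apply: is_subspaceZ.
split=> [phi phiP|a x y Ux Uy phi phiP]; first by rewrite contract0 //; case: UP.
rewrite contractD //; apply: is_subspaceD => //; last exact: Uy.
(* Contracting [a *: x] by [phi] is contracting [x] by the functional [k |-> phi (a * k)]; hence the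
   claim ranges over all functionals at once. *)
have aphiP : scalar (fun k : KF => phi (a * (k : K))).
  by move=> c k l; rewrite -phiP; congr phi; rewrite mulrDr !restricted_scaleE mulrCA.
suff -> : contract phi (a *: x) = contract (fun k : KF => phi (a * (k : K))) x by exact: Ux.
elim/ext_ind: x {Ux} => [|b v x IH]; first by rewrite scaler0 !contract0.
by rewrite scalerDr tens_scale !contractD // IH !contract_tens.
Qed.

Definition minimal_rep (s : seq (K * V)) : Prop :=
  forall t, ext_class iota t = ext_class iota s -> (size s <= size t)%N.

Lemma minimal_rep_exists (x : ext_space iota V) :
  exists2 s, ext_class iota s = x & minimal_rep s.
Proof.
pose P n := `[< exists2 s, ext_class iota s = x & size s = n >].
have exP : exists n, P n.
  by exists (size (ext_repr x)); apply/asboolP; exists (ext_repr x); rewrite ?ext_reprK.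
have /asboolP[s sx sn] : P (ex_minn exP) by case: ex_minnP.
exists s => // t tx; rewrite sn; case: ex_minnP => m _; apply.
by apply/asboolP; exists t => //; rewrite tx.
Qed.

(* The left factors of a shortest representation are linearly independent over F *)
Lemma minimal_rep_functional k v s : minimal_rep ((k, v) :: s) ->
  exists2 phi : KF -> F, scalar phi &
    contract phi (ext_class iota ((k, v) :: s)) = v.
Proof.
move=> min; pose U := Defs.span (fun a : KF => (a : K) \in unzip1 s).
(* A tensor whose left factor already occurs merges into that entry without lengthening the list.
   Moving scalars across, [absorb] extends this to the span of the left factors. *)
have absorb1 (b : K) w r : b \in unzip1 r ->
    exists2 t, unzip1 t = unzip1 r & ext_class iota t = tens iota b w + ext_class iota r.
  elim: r => [|[c u] r IHr] //; rewrite inE => /orP[/eqP /= <-|/IHr[t tr tE]].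
    exists ((b, w + u) :: r) => //; rewrite !ext_class_sum !big_cons /=.
    by rewrite tens_addr addrA.
  exists ((c, u) :: t); first by rewrite /= tr.
  by rewrite !ext_class_sum !big_cons -!ext_class_sum tE addrCA.
have absorb (a : KF) : U a -> forall w r, unzip1 r = unzip1 s ->
    exists2 t, unzip1 t = unzip1 s & ext_class iota t = tens iota (a : K) w + ext_class iota r.
  elim=> [|c x y xs _ IH] w r rs.
    by exists r => //; rewrite tens_zerol add0r.
  have [t ts tE] := IH w r rs.
  have [t' t's t'E] : exists2 t', unzip1 t' = unzip1 t &
      ext_class iota t' = tens iota (x : K) (c *: w) + ext_class iota t.
    by apply: absorb1; rewrite ts.
  exists t'; first by rewrite t's.
  rewrite t'E tE addrA; congr (_ + _).
  by rewrite tens_addl tens_balance tens_scale.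
(* Otherwise the leading tensor could be absorbed into [s], giving a shorter representation. *)
have Uk : ~ U (k : KF).
  move=> /absorb/(_ v s erefl)[t ts tE].
  have /(congr1 size) := ts; rewrite !size_map => st.
  have /min : ext_class iota t = ext_class iota ((k, v) :: s).
    by rewrite tE !ext_class_sum big_cons.
  by rewrite st ltnn.
have [phi [phiP phik phiU]] := separating_functional (@span_subspace F KF _) Uk.
exists phi => //; rewrite contract_class // big_cons /= phik scale1r big_seq.
rewrite big1 ?addr0 // => p ps; rewrite phiU ?scale0r //.
by apply: span_gen; apply: map_f.
Qed.

(** The first right factor of a shortest representation is a contraction of [x]; were it zero, its
    tensor could be dropped. *)
Lemma contract_separates (x : ext_space iota V) :
  (forall phi : KF -> F, scalar phi -> contract phi x = 0) -> x = 0.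
Proof.
move=> x0; have [s sx min] := minimal_rep_exists x; case: s => [|[k v] s] in sx min *.
  by rewrite -sx.
have [phi phiP] := minimal_rep_functional min.
rewrite sx x0 // => v0; have /min : ext_class iota s = ext_class iota ((k, v) :: s).
  by rewrite !ext_class_sum big_cons -v0 tens_zeror add0r.
by rewrite ltnn.
Qed.

Lemma tens1_neq0 (v : V) : v <> 0 -> tens iota 1 v <> 0.
Proof.
move=> v0; have [||phi [phiP phi1 _]] := @separating_functional F KF (fun x => x = 0) (1 : K).
- by split=> // a x y -> ->; rewrite scaler0 addr0.
- by move/eqP; rewrite oner_eq0.
- by move/(congr1 (contract phi)); rewrite contract_tens // phi1 scale1r contract0.
Qed.

End Contraction.

(** * Submodules generated by homogeneous vectors *)

Lemma hcomp_grz (F : fieldType) (V : lmodType F) (gr : nat -> V -> Prop)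
  (grP : is_grading gr) (c : int) (n : nat) x :
  grz gr c x -> hcomp grP n x = if c == n then x else 0.
Proof.
case: c => p /=; first by move=> xp; rewrite (hcomp_hom grP n xp) eq_sym.
by move=> ->; rewrite (hcomp_hom grP (p := n)) ?if_same //; case: (grading_sub grP n).
Qed.

Lemma binzn0 m : binz m 0 = 1.
Proof. by case: m => n /=; rewrite bin0 ?mulr1. Qed.

Section Generated.
Variables (F : fieldType) (V : voa F) (M : admissible_module V).
Let MP := adm_weak M.
Let Mb n : bilin (fun (u : V) (w : M) => mop u n w) := wm_bilin MP n.
Let grM := adm_grading M.

(** One mode per vector is enough, as [generated_stable] shows, and this form lets the degree-zero
    part be found by counting degrees. *)
Definition generated (N : M -> Prop) : M -> Prop :=
  Defs.span (fun x => exists u n w, N w /\ x = mop u n w).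

Variable N : M -> Prop.

Lemma generated_subspace : is_subspace (generated N).
Proof. exact: span_subspace. Qed.

Lemma generated_mop u n w : N w -> generated N (mop u n w).
Proof. by move=> Nw; apply: span_gen; exists u, n, w. Qed.

Lemma generated_mem w : N w -> generated N w.
Proof. by move=> /(generated_mop (vacuum V) (-1)); rewrite (wm_vacuum MP). Qed.

Lemma hcomp_zero n : hcomp grM n 0 = 0.
Proof.
by rewrite (hcomp_hom grM (p := n)) ?if_same //; case: (grading_sub grM n).
Qed.

(* Weak associativity: if [v_j w = 0] for [j >= l], the Jacobi identity with
   [m = l] writes [v_a u_b w] modulo [V w] in terms of the [v_(a-i) u_(b+i) w], [i > 0]. *)
Lemma generated_stable v a x : generated N x -> generated N (mop v a x).
Proof.
have GP := generated_subspace.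
move: x; apply: span_min => [|_ [u [b [w [Nw ->]]]]].
  split=> [|c x y Gx Gy]; first by rewrite (bilin0r (Mb a)); case: GP.
  by rewrite (Mb a).2; apply: GP.2.
have [l lP] := wm_trunc MP v w; have [B BP] := wm_trunc MP u w.
(* Induction on how far [b] lies below the bound [B] from which on the modes of [u] kill [w]; the
   correction terms have a larger [b]. *)
have [d] : exists d : nat, B%:Z - b <= d%:Z by exists `|B%:Z - b|%N; lia.
elim: d b a => [|d IH] b a dB.
  have [n bE Bn] : exists2 n : nat, b = n & (B <= n)%N by exists `|b|%N; lia.
  by rewrite bE BP // (bilin0r (Mb a)); case: GP.
have [K /(_ K.+1 (leqnSn K))] := wm_jacobi MP v u w l (a - l%:Z) b.
rewrite /jacobi_commutator big_ord_recl binzn0 expr0 mul1r mulr1z.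
rewrite [mop v (l%:Z + 0)  _](_ : _ = 0); last by rewrite addr0 lP.
rewrite (bilin0r (Mb _)) mul0rz subr0 /=.
have -> : l%:Z + (a - l%:Z) - 0%:Z = a by lia.
rewrite addr0 => /eqP; rewrite eq_sym -subr_eq => /eqP <-; apply: is_subspaceB => //.
  apply: is_subspace_sum => // i _; apply: is_subspaceMz => //; exact: generated_mop.
apply: is_subspace_sum => // i _; apply: is_subspaceMz => //; apply: is_subspaceB => //.
  by apply: IH; rewrite /bump; lia.
by rewrite -PoszD lP ?leq_addr // (bilin0r (Mb _)) mul0rz; case: GP.
Qed.

Variable t : nat.
Hypothesis Nt : forall w, N w -> mgr M t w.

(** As [N] sits in the single degree [t], modes of homogeneous [u] send it to homogeneous vectors,
    so each component of a generator is a sum of generators. *)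
Lemma generated_hcomp n x : generated N x -> generated N (hcomp grM n x).
Proof.
have GP := generated_subspace; move: x; apply: span_min => [|_ [u [b [w [Nw ->]]]]].
  split=> [|c x y Gx Gy]; first by rewrite hcomp_zero; case: GP.
  by rewrite hcomp_linear; apply: GP.2.
have L := hcomp_linear grM n.
have HD : {morph hcomp grM n : x y / x + y} by move=> x y; have := L 1 x y; rewrite !scale1r.
rewrite (hcomp_sum (voa_grading V) u) (bilin_suml (Mb b)) (big_morph _ HD (hcomp_zero n)).
apply: is_subspace_sum => // p _; have up := hcomp_gr (voa_grading V) p u.
rewrite (hcomp_grz grM n (adm_degree b up (Nt Nw))); case: eqP => _.
  exact: generated_mop.
by case: GP.
Qed.

Lemma generated_submodule : admissible_submodule (generated N).
Proof.
split=> [|u n w|w Gw]; [exact: generated_subspace|exact: generated_stable|].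
exists (hdeg grM w), (fun i => hcomp grM i w); split; last exact: hcomp_sum.
by split; [exact: hcomp_gr|exact: generated_hcomp].
Qed.

(** For [u] of weight [p], only the mode [p + t - 1] can take degree [t] to a nonzero vector of
    degree 0. *)
Lemma generated_top (P : M -> Prop) : is_subspace P ->
  (forall p u w, vgr V p u -> N w -> P (mop u (p%:Z + t%:Z - 1) w)) ->
  forall x, generated N x -> mgr M 0 x -> P x.
Proof.
(* A sum of degree 0 may have terms of other degrees, so the induction runs over degree-zero
   components. *)
move=> PP NP; suff H x : generated N x -> P (hcomp grM 0 x).
  by move=> x Gx x0; have := H x Gx; rewrite (hcomp_hom grM 0 x0).
move: x; apply: span_min => [|_ [u [b [w [Nw ->]]]]].
  split=> [|c x y Gx Gy]; first by rewrite hcomp_zero; case: PP.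
  by rewrite hcomp_linear; apply: PP.2.
have L := hcomp_linear grM 0.
have HD : {morph hcomp grM 0 : x y / x + y} by move=> x y; have := L 1 x y; rewrite !scale1r.
rewrite (hcomp_sum (voa_grading V) u) (bilin_suml (Mb b)) (big_morph _ HD (hcomp_zero 0)).
apply: is_subspace_sum => // p _; have up := hcomp_gr (voa_grading V) p u.
rewrite (hcomp_grz grM 0 (adm_degree b up (Nt Nw))); case: eqP => E; last by case: PP.
have -> : b = p%:Z + t%:Z - 1 by lia.
exact: NP.
Qed.

End Generated.

(** This mode lowers degrees by exactly [t], so only the component of degree [t] lands in degree
    0. *)
Lemma hcomp_lowering (F : fieldType) (V : voa F) (M : admissible_module V) p t u (x : M) :
  vgr V p u -> hcomp (adm_grading M) 0 (mop u (p%:Z + t%:Z - 1) x) =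
    mop u (p%:Z + t%:Z - 1) (hcomp (adm_grading M) t x).
Proof.
move=> up; have Mb := wm_bilin (adm_weak M) (p%:Z + t%:Z - 1).
have L := hcomp_linear (adm_grading M) 0.
have HD : {morph hcomp (adm_grading M) 0 : x y / x + y}.
  by move=> y z; have := L 1 y z; rewrite !scale1r.
(* The bound is enlarged so that the index [t] occurs in the sum even beyond [hdeg]. *)
have tD : (t < maxn t.+1 (hdeg (adm_grading M) x))%N by rewrite leq_maxl.
rewrite {1}(hcomp_sumN (leq_maxr t.+1 (hdeg (adm_grading M) x))).
rewrite (bilin_sumr Mb) (big_morph _ HD (hcomp_zero M 0)).
have E i := hcomp_grz (adm_grading M) 0
  (adm_degree (p%:Z + t%:Z - 1) up (hcomp_gr (adm_grading M) i x)).
rewrite (bigD1 (Ordinal tD)) //= E big1 ?addr0 => [|i it].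
  by case: eqP => // ne; case: ne; lia.
by rewrite E; case: eqP => // E'; case/eqP: it; apply: val_inj => /=; lia.
Qed.

(** * Irreducible modules and their top level *)

Section Irreducible.
Variables (F : fieldType) (V : voa F) (M : admissible_module V).
Hypothesis M_irr : irreducible_module M.
Hypothesis M0_ne0 : exists w : M, mgr M 0 w /\ w <> 0.

Let Mb n : bilin (fun (u : V) (w : M) => mop u n w) := wm_bilin (adm_weak M) n.
Let grM := adm_grading M.

Lemma generated_full (N : M -> Prop) t w : (forall w, N w -> mgr M t w) -> N w ->
  w <> 0 -> forall x, generated N x.
Proof.
move=> Nt Nw w0; have [G0|//] := M_irr.2 _ (generated_submodule Nt).
by case: w0; apply/G0/generated_mem.
Qed.

Lemma lowering_kernel t w : mgr M t w ->
  (forall p u, vgr V p u -> mop u (p%:Z + t%:Z - 1) w = 0) -> w = 0.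
Proof.
move=> wt kw; apply: contrapT => w0.
have [w' [w'0]] := M0_ne0; apply.
have Nt x : x = w -> mgr M t x by move=> ->.
(* With the zero subspace as [P], the submodule generated by [w] meets degree 0 trivially, yet by
   irreducibility it contains [w']. *)
apply: (generated_top (P := fun x => x = 0) Nt) w'0 => [|p u _ up ->|].
- by split=> // a x y -> ->; rewrite scaler0 addr0.
- exact: kw.
- exact: (generated_full Nt (erefl w) w0 w').
Qed.

Lemma generated_by_top x : generated (mgr M 0) x.
Proof. by have [w [w0 wn0]] := M0_ne0; apply: (generated_full (t := 0)) w0 wn0 x. Qed.

(** A nonzero submodule of [M(0)] generates all of [M], but in degree 0 this produces only its
    images under zero modes, which it contains already. *)
Lemma zhu_top_simple : simple_module (zhu_top M).
Proof.
split=> [|N NP Nact].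
  have [w [w0 wn0]] := M0_ne0; exists (@sub_space_mk _ _ (top_space M) w w0).
  by move/(congr1 val).
pose N' w := exists2 y, N y & val y = w.
have N't w : N' w -> mgr M 0 w by move=> [y _ <-]; apply: sub_spaceP.
have N'P : is_subspace N'.
  split=> [|a _ _ [x Nx <-] [y Ny <-]]; first by exists 0 => //; case: NP.
  by exists (a *: x + y); [apply: NP.2|rewrite sub_space_valP].
have [N0|/existsNP[y /not_implyP[Ny y0]]] := pselect (forall y, N y -> y = 0).
  by left.
have full := generated_full N't (ex_intro2 _ _ y Ny erefl).
have {}full x : generated N' x by apply: full => /= E; apply: y0; apply: val_inj.
right=> x; suff [z Nz /val_inj <- //] : N' (val x).
apply: (generated_top N't) (full _) (sub_spaceP x) => // p u w up [z Nz <-].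
exists (zhu_act (quot_class (zhu_O V) u) z); first exact: Nact.
by rewrite zhu_actE (zero_mode_hom _ up) addr0.
Qed.

(** The modes lowering degree [t > 0] to 0 kill [w] and commute with [f]. They therefore kill the
    degree [t] component of [f w], which vanishes by [lowering_kernel]. *)
Lemma End_voa_top (f : {linear M -> M}) w : End_voa f -> mgr M 0 w -> mgr M 0 (f w).
Proof.
move=> fE w0.
suff H t : (0 < t)%N -> hcomp grM t (f w) = 0.
  have [d0|d0] := posnP (hdeg grM (f w)).
    by rewrite (hcomp_sum grM (f w)) d0 big_ord0; case: (grading_sub grM 0).
  rewrite (hcomp_sum grM (f w)) (bigD1 (Ordinal d0)) //= big1 ?addr0; last first.
    by move=> i i0; apply: H; rewrite lt0n.
  exact: hcomp_gr.
move=> t0; apply: (lowering_kernel (hcomp_gr _ _ _)) => p u up.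
rewrite -hcomp_lowering // -fE (top_annihilate up w0) ?raddf0 ?hcomp_zero //; lia.
Qed.

Lemma End_voa_scalar (f : {linear M -> M}) c : End_voa f ->
  (forall w, mgr M 0 w -> f w = c *: w) -> forall w, f w = c *: w.
Proof.
move=> fE fc w; move: w (generated_by_top w).
apply: span_min => [|_ [u [n [w [w0 ->]]]]].
  split=> [|a x y fx fy]; first by rewrite raddf0 scaler0.
  by rewrite linearP fx fy scalerDr !scalerA mulrC.
by rewrite fE fc // (bilinZr (Mb n)).
Qed.
End Irreducible.

(** * The top level of an extended module *)

Section ExtendInclusion.
Variables (F K : fieldType) (iota : {rmorphism F -> K}) (V : lmodType F).
Variable U : subspace V.

(** [K (x) U] and the subspace [ext_sub U] of [K (x) V] are distinct types; this map identifies
    them. *)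
Definition ext_incl : ext_space iota (sub_space U) -> ext_space iota V :=
  ext_lift (fun w => tens iota 1 (val w)).

Let gD (v w : sub_space U) :
  tens iota 1 (val (v + w)) = tens iota 1 (val v) + tens iota 1 (val w).
Proof. by rewrite -tens_addr. Qed.

Let gZ c (v : sub_space U) : tens iota 1 (val (c *: v)) = iota c *: tens iota 1 (val v).
Proof. by rewrite -tens_balance. Qed.

Lemma ext_incl_linear : linear ext_incl.
Proof. exact: ext_lift_linear gD gZ. Qed.

HB.instance Definition _ := GRing.isLinear.Build K _ _ _ ext_incl ext_incl_linear.

Lemma ext_incl_tens a w : ext_incl (tens iota a w) = tens iota a (val w).
Proof. by rewrite /ext_incl ext_lift_tens // tens_scale mulr1. Qed.

Lemma ext_inclP x : ext_sub U (ext_incl x).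
Proof.
elim/ext_ind: x => [|a w x IH]; first by rewrite raddf0; apply: span_zero.
rewrite raddfD /= ext_incl_tens; apply: is_subspaceD (@span_subspace K _ _) _ _ _ IH.
by apply: ext_sub_tens; apply: sub_spaceP.
Qed.

Lemma ext_sub_incl y : ext_sub U y -> exists x, y = ext_incl x.
Proof.
move: y; apply: ext_sub_min => [|a v Uv].
  split=> [|a _ _ [x ->] [y ->]]; first by exists 0; rewrite raddf0.
  by exists (a *: x + y); rewrite linearP.
by exists (tens iota a (sub_space_mk Uv)); rewrite ext_incl_tens.
Qed.

Lemma contract_incl (phi : restricted iota -> F) x : scalar phi ->
  contract phi (ext_incl x) = val (contract phi x).
Proof.
move=> phiP; elim/ext_ind: x => [|a w x IH]; first by rewrite raddf0 !contract0.
by rewrite raddfD /= ext_incl_tens !contractD // !contract_tens // IH.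
Qed.

(** Contraction commutes with the inclusion, and contractions separate points. *)
Lemma ext_incl_inj : injective ext_incl.
Proof.
move=> x y /eqP; rewrite -subr_eq0 -raddfB => /eqP xy.
apply/eqP; rewrite -subr_eq0; apply/eqP/contract_separates => phi phiP.
by apply: val_inj; rewrite -contract_incl // [ext_incl _]xy contract0.
Qed.

End ExtendInclusion.

Section ExtendTop.
Variables (F K : fieldType) (iota : {rmorphism F -> K}) (V : voa F).
Variable M : admissible_module V.
Local Notation S := (ext_alg_module iota (zhu_top M)).
Local Notation MK := (ext_module iota M).
Local Notation T := (tens iota).
Let Mb n : bilin (fun (u : V) (w : M) => mop u n w) := wm_bilin (adm_weak M) n.
Let MKb n : bilin (fun (x : ext_voa iota V) (y : MK) => mop x n y) :=
  wm_bilin (adm_weak MK) n.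
Let Sb : bilin (fun (a : ext_algebra iota (zhu_algebra V)) (s : S) => act a s) := act_bilin S.

Definition ext_top : S -> MK := @ext_incl F K iota M (top_space M).

Lemma ext_top_linear : linear ext_top.
Proof. exact: ext_incl_linear. Qed.
HB.instance Definition _ := GRing.isLinear.Build K _ _ _ ext_top ext_top_linear.

Lemma ext_top_tens a (w : zhu_top M) : ext_top (T a w) = T a (val w).
Proof. exact: ext_incl_tens. Qed.

Lemma ext_mop_tens a u n b (w : M) :
  mop (T a u : ext_voa iota V) n (T b w : MK) = T (a * b) (mop u n w).
Proof. exact: ext_op_tens (Mb n) _ _ _ _. Qed.

Lemma ext_act_tens a (u : zhu_algebra V) b (w : zhu_top M) :
  act (T a u : ext_algebra iota (zhu_algebra V)) (T b w : S) = T (a * b) (act u w).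
Proof. exact: ext_op_tens (act_bilin _) _ _ _ _. Qed.

Lemma ext_top_act a p u (z : S) : vgr V p u ->
  ext_top (act (T a (quot_class (zhu_O V) u) : ext_algebra iota (zhu_algebra V)) z) =
    mop (T a u : ext_voa iota V) (p%:Z - 1) (ext_top z).
Proof.
move=> up; elim/ext_ind: z => [|b w z IH].
  by rewrite (bilin0r Sb) raddf0 (bilin0r (MKb _)).
rewrite (bilinDr Sb) !raddfD (bilinDr (MKb _)) -IH; congr (_ + _).
rewrite ext_act_tens; transitivity (T (a * b) (mop u (p%:Z - 1) (val w)) : MK).
  apply: etrans (ext_top_tens _ _) _; congr (T _ _).
  by rewrite zhu_actE (zero_mode_hom _ up).
by rewrite -ext_mop_tens; congr (mop _ _ _); apply: esym (ext_top_tens _ _).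
Qed.

(** Every element of [K (x) A(V)] is a sum of tensors [a (x) [u]] with [u] homogeneous, and these
    act by zero modes. *)
Lemma ext_top_stable (P : MK -> Prop) : is_subspace P ->
  (forall a p u x, vgr V p u -> P x -> P (mop (T a u : ext_voa iota V) (p%:Z - 1) x)) ->
  forall (a : ext_algebra iota (zhu_algebra V)) z, P (ext_top z) -> P (ext_top (act a z)).
Proof.
move=> PP Pm a z Pz; elim/ext_ind: a => [|a q x IH].
  by rewrite (bilin0l Sb) raddf0; case: PP.
rewrite (bilinDl Sb) raddfD; apply: is_subspaceD => // {x IH}.
rewrite -(quot_reprK q); move: (quot_repr q) => u.
have -> : T a (quot_class (zhu_O V) u) = \sum_(p < hdeg (voa_grading V) u)
    T a (quot_class (zhu_O V) (hcomp (voa_grading V) p u)) :> ext_algebra iota (zhu_algebra V).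
  by rewrite {1}(hcomp_sum (voa_grading V) u) !raddf_sum.
rewrite (bilin_suml Sb) raddf_sum.
apply: is_subspace_sum => // p _; have up := hcomp_gr (voa_grading V) p u.
by rewrite /= (ext_top_act _ _ up); apply: Pm.
Qed.

Lemma ext_topP z : mgr MK 0 (ext_top z).
Proof. exact: (@ext_inclP F K iota M (top_space M)). Qed.

Lemma ext_top_surj y : mgr MK 0 y -> exists z, y = ext_top z.
Proof. exact: (@ext_sub_incl F K iota M (top_space M)). Qed.

Lemma ext_top_inj : injective ext_top.
Proof. exact: (@ext_incl_inj F K iota M (top_space M)). Qed.

Lemma ext_top_simple : (exists w : M, mgr M 0 w /\ w <> 0) ->
  irreducible_module MK -> simple_module S.
Proof.
move=> [w [w0 wn0]] MK_irr.
have MK0 : exists y : MK, mgr MK 0 y /\ y <> 0.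
  by exists (T 1 w); split; [apply: ext_sub_tens|apply: tens1_neq0].
split.
  have [y [/ext_top_surj[z ->] z0]] := MK0; exists z => zE.
  by apply: z0; rewrite zE raddf0.
move=> N NP Nact; pose N' w := exists2 y, N y & ext_top y = w.
have N't y : N' y -> mgr MK 0 y by move=> [z _ <-]; apply: ext_topP.
have N'P : is_subspace N'.
  split=> [|a _ _ [x Nx <-] [y Ny <-]]; first by exists 0; [case: NP|rewrite raddf0].
  by exists (a *: x + y); [apply: NP.2|rewrite linearP].
have [N0|/existsNP[y /not_implyP[Ny y0]]] := pselect (forall y, N y -> y = 0).
  by left.
have full : forall x, generated N' x.
  apply: (generated_full MK_irr N't (ex_intro2 _ _ y Ny erefl)) => E.
  by apply: y0; apply: ext_top_inj; rewrite E raddf0.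
right=> x; suff [z Nz /ext_top_inj <- //] : N' (ext_top x).
apply: (generated_top N't N'P) (full _) (ext_topP x) => p u _ up [z Nz <-].
(* Vectors of weight [p] in the extended algebra are combinations of [T a u] with [u] of weight [p]
   in [V]. *)
rewrite addr0; move: u up; apply: ext_sub_min => [|a u up].
  split=> [|a u v Nu Nv]; first by rewrite (bilin0l (MKb _)); case: N'P.
  by rewrite (MKb _).1; apply: N'P.2.
rewrite -ext_top_act //; eexists; last by [].
exact: Nact.
Qed.

(** A nonzero graded submodule is lowered into degree 0, where it fills the simple top level, and
    this generates everything. *)
Lemma ext_irreducible : irreducible_module M -> (exists w : M, mgr M 0 w /\ w <> 0) ->
  simple_module S -> irreducible_module MK.
Proof.
move=> M_irr M0 S_simple; split=> [|N [NP Nst Ngr]].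
  have [z z0] := S_simple.1; exists (ext_top z) => E.
  by apply: z0; apply: ext_top_inj; rewrite E raddf0.
have [N0|/existsNP[x /not_implyP[Nx x0]]] := pselect (forall y, N y -> y = 0).
  by left.
right; have [d [xs [xsP xE]]] := Ngr x Nx.
have [n xn0] : exists n, xs n <> 0.
  by apply: contrapT => /forallNP xs0; apply: x0; rewrite xE big1 // => i _;
    apply: contrapT; apply: xs0.
have [xn Nxn] := xsP n; move: (xs n) xn0 xn Nxn => {xs xsP xE d x x0 Nx} x x0 xn Nx.
(* If all these modes killed [x], every contraction of [x] would be a vector of [M] of degree [n]
   killed by the lowering modes, hence zero. *)
have [p [u [up y0]]] : exists p u, vgr V p u /\
    mop (T 1 u : ext_voa iota V) (p%:Z + n%:Z - 1) (x : MK) <> 0.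
  apply: contrapT => nx; apply/x0/contract_separates => phi phiP.
  apply: (lowering_kernel M_irr M0 (t := n)) => [|p u up].
    exact: contract_sub (grading_sub (adm_grading M) n) xn phi phiP.
  rewrite -(contract_op _ _ (Mb _)) //; apply: contrapT => y0; apply: nx.
  by exists p, u; split=> // E; apply: y0; rewrite [ext_op _ _ _]E contract0.
have up1 : vgr (ext_voa iota V) p (T 1 u) by apply: ext_sub_tens.
have := adm_degree (p%:Z + n%:Z - 1) up1 xn.
have -> : p%:Z + n%:Z - (p%:Z + n%:Z - 1) - 1 = 0%:Z by lia.
move=> /ext_top_surj[z zE].
have Nz : N (ext_top z) by rewrite -zE; apply: Nst.
have Ntop : forall z, N (ext_top z).
  have [|a z' Nz'|N0|//] := S_simple.2 (fun z => N (ext_top z)).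
  - split=> [|a z1 z2 N1 N2]; first by rewrite raddf0; case: NP.
    by rewrite linearP; apply: NP.2.
  - by apply: ext_top_stable Nz' => // b q v y _; apply: Nst.
  - by case: y0; rewrite zE (N0 z) ?raddf0.
suff NT a (v : M) : N (T a v).
  by elim/ext_ind => [|a v y Ny]; [case: NP|apply: is_subspaceD].
move: a; have := generated_by_top M_irr M0 v; move: v.
apply: span_min => [|_ [v [m [w [w0 ->]]]] a].
  split=> [a|c v w Nv Nw a]; first by rewrite tens_zeror; case: NP.
  by rewrite tens_addr tens_balance; apply: NP.2.
rewrite -[a]mul1r -ext_mop_tens; apply: Nst.
by have := Ntop (T a (@sub_space_mk _ _ (top_space M) w w0)); rewrite ext_top_tens.
Qed.

End ExtendTop.

(** * Absolutely simple modules and scalar endomorphisms *)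

Section Density.
Variables (F : fieldType) (A : assoc_algebra F) (S : alg_module A).
Hypothesis S_simple : simple_module S.
Let Sb : bilin (fun (a : A) (s : S) => act a s) := act_bilin S.

Lemma simple_cyclic (s y : S) : s <> 0 -> exists a : A, act a s = y.
Proof.
move=> s0; have [|a x [b <-]|N0|//] := S_simple.2 (fun y => exists a, act a s = y).
- split=> [|c _ _ [a <-] [b <-]]; first by exists 0; rewrite (bilin0l Sb).
  by exists (c *: a + b); rewrite (bilinDl Sb) (bilinZl Sb).
- by exists (amul a b); rewrite actM.
- by case: s0; apply: N0; exists (aone A); rewrite act1.
Qed.

Hypothesis End_scalars : is_scalars (@End_alg F A S).

(** The condition on annihilators makes [a s |-> a s'] well defined on [S = A s]; it commutes with
    [A], so it is a scalar. *)
Lemma annihilator_proportional (s s' : S) : s <> 0 ->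
  (forall a : A, act a s = 0 -> act a s' = 0) -> exists c, s' = c *: s.
Proof.
move=> s0 ann; pose f y := act (sval (cid (simple_cyclic y s0))) s'.
have fE a : f (act a s) = act a s'.
  rewrite /f; case: cid => b /= bs; apply/eqP; rewrite -subr_eq0 -(bilinNl Sb).
  by rewrite -(bilinDl Sb) ann // (bilinDl Sb) (bilinNl Sb) bs subrr.
have fL : linear f.
  move=> c x y; have [a <-] := simple_cyclic x s0; have [b <-] := simple_cyclic y s0.
  rewrite -(bilinZl Sb) -(bilinDl Sb) !fE.
  by rewrite (bilinDl Sb) (bilinZl Sb).
pose h : {linear S -> S} := HB.pack f (GRing.isLinear.Build F S S _ f fL).
have [c cP] : exists c : F, forall x, h x = c *: x.
  apply/(End_scalars h) => a x; have [b <-] := simple_cyclic x s0.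
  by rewrite -actM /= !fE actM.
by exists c; rewrite -cP /= -[s in f s]act1 fE act1.
Qed.

Variables (K : fieldType) (iota : {rmorphism F -> K}).
Local Notation T := (tens iota).
Local Notation SK := (ext_alg_module iota S).
Let SKb : bilin (fun (a : ext_algebra iota A) (s : SK) => act a s) := act_bilin SK.

(* An element of N with the fewest tensors is a pure tensor: any operator killing
   its first right factor annihilates it, so its contractions are all multiples of
   that factor. *)
Lemma ext_simple : simple_module SK.
Proof.
have [[s0 s0n] _] := S_simple.
split=> [|N NP Nact]; first by exists (T 1 s0); apply: tens1_neq0.
have [N0|/existsNP[x /not_implyP[Nx x0]]] := pselect (forall y, N y -> y = 0).
  by left.
right; pose P n := `[< exists s, [/\ size s = n, N (ext_class iota s) &
  ext_class iota s <> 0] >].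
have exP : exists n, P n.
  by exists (size (ext_repr x)); apply/asboolP; exists (ext_repr x); rewrite ext_reprK.
have [s [Ns sn0 min]] : exists s, [/\ N (ext_class iota s), ext_class iota s <> 0 &
    forall t, N (ext_class iota t) -> ext_class iota t <> 0 -> (size s <= size t)%N].
  case: (ex_minnP exP) => n /asboolP[s [sn Ns s0']] nmin; exists s; split=> // t Nt t0.
  by rewrite sn; apply: nmin; apply/asboolP; exists t.
have min_rep t : ext_class iota t = ext_class iota s -> (size s <= size t)%N.
  by move=> tE; apply: min; rewrite tE.
case: s => [|[k v] s] in Ns sn0 min min_rep *.
  by case: sn0; rewrite ext_class_sum big_nil.
have consE p r : ext_class iota (p :: r) = T p.1 p.2 + ext_class iota r.
  by rewrite !ext_class_sum big_cons.
have v0 : v <> 0.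
  move=> v0; have /min_rep : ext_class iota s = ext_class iota ((k, v) :: s).
    by rewrite consE v0 tens_zeror add0r.
  by rewrite ltnn.
have colinear (phi : restricted iota -> F) : scalar phi ->
    exists c, contract phi (ext_class iota ((k, v) :: s)) = c *: v.
  move=> phiP; apply: annihilator_proportional v0 _ => a av.
  have actE r : act (T 1 a : ext_algebra iota A) (ext_class iota r : SK) =
      ext_class iota [seq (p.1, act a p.2) | p <- r].
    elim: r => [|p r IH]; first by rewrite !ext_class_sum !big_nil (bilin0r SKb).
    rewrite [map _ _]/= !consE; apply: etrans (bilinDr SKb _ _ _) _; rewrite IH.
    by congr (_ + _); apply: etrans (ext_op_tens _ (act_bilin S) _ _ _ _) _; rewrite mul1r.
  rewrite -(contract_op _ _ Sb) // [ext_op _ _ _]actE.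
  set r := map _ _; have [-> //|r0] := pselect (ext_class iota r = 0).
    by rewrite contract0.
  (* As [a] kills [v], the first tensor drops out, and a nonzero image in [N] would contradict the
     minimal length. *)
  have rE : ext_class iota r = ext_class iota (behead r).
    by rewrite consE /= av tens_zeror add0r.
  have : N (ext_class iota r) by rewrite -actE; apply: Nact.
  by rewrite rE in r0 * => /min/(_ r0); rewrite size_map ltnn.
case: s => [|[l w] s] in Ns sn0 min min_rep colinear *; last first.
  (* A second tensor [l (x) w], moved to the front, makes [w] a contraction, hence a multiple of
     [v]; the two tensors then merge. *)
  have swapE : ext_class iota [:: (l, w), (k, v) & s] = ext_class iota [:: (k, v), (l, w) & s].
    by rewrite !consE addrCA.
  have [|phi phiP] := @minimal_rep_functional F K iota S l w ((k, v) :: s).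
    by move=> t; rewrite swapE => /min_rep.
  rewrite swapE; have [c ->] := colinear phi phiP => wE.
  have /min_rep : ext_class iota ((k + iota c * l, v) :: s) =
      ext_class iota [:: (k, v), (l, w) & s].
    by rewrite !consE /= -wE tens_addl tens_balance tens_scale addrA.
  by rewrite ltnn.
have k0 : k != 0.
  by apply/eqP => k0; apply: sn0; rewrite consE /= k0 tens_zerol ext_class_sum big_nil add0r.
elim/ext_ind => [|b y z Nz]; first by case: NP.
apply: is_subspaceD => //; have [a <-] := simple_cyclic y v0.
have -> : T b (act a v) = act (T (b / k) a : ext_algebra iota A) (T k v : SK).
  by rewrite [RHS](ext_op_tens _ (act_bilin S)) divfK.
exact: Nact.
Qed.

End Density.

(** * The bicommutant field of an endomorphism *)

Section Bicommutant.
Variables (F : fieldType) (A : assoc_algebra F) (S : alg_module A).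
Let Sb : bilin (fun (a : A) (s : S) => act a s) := act_bilin S.

(** Plain functions are used so that the bicommutant is a subspace of [S -> S]. *)
Definition alg_endo (f : S -> S) : Prop :=
  linear f /\ forall (a : A) x, f (act a x) = act a (f x).

Variable d : S -> S.
Hypothesis dE : alg_endo d.
Hypothesis S_simple : simple_module S.

Definition bicommutes (f : S -> S) : Prop :=
  alg_endo f /\ forall g, alg_endo g -> (forall x, g (d x) = d (g x)) ->
    forall x, f (g x) = g (f x).

Let endo0 f : alg_endo f -> f 0 = 0.
Proof.
move=> [fL _]; have := fL 1 0 0; rewrite !scale1r addr0 => /eqP.
by rewrite -subr_eq subrr => /eqP.
Qed.

Lemma bicommutes_subspace : is_subspace bicommutes.
Proof.
split=> [|c f g [[fL fA] fC] [[gL gA] gC]].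
  split; last by move=> g /endo0 g0 _ x; rewrite [LHS]/(0) [(0 : S -> S) x]/(0) g0.
  by split=> [a x y|a x]; rewrite ?(bilin0r Sb) // [RHS]addr0 scaler0.
have E x : (c *: f + g) x = c *: f x + g x by [].
split=> [|h hE hd x]; last by rewrite !E fC // gC // hE.1.
split=> [a x y|a x]; rewrite !E; last by rewrite fA gA (bilinDr Sb) (bilinZr Sb).
by rewrite fL gL !scalerDr !scalerA (mulrC c) addrACA.
Qed.

Definition bicommutant : Type := sub_space (Subspace bicommutes_subspace).
Local Notation K := bicommutant.
HB.instance Definition _ := GRing.Lmodule.on K.

Definition bicommutant_fun (f : K) : S -> S := val f.
Local Notation fn := bicommutant_fun.

Lemma bicommutantP (f : K) : bicommutes (fn f).
Proof. exact: (@sub_spaceP F (S -> S) (Subspace bicommutes_subspace) f). Qed.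

Lemma bicommutant_eq (f g : K) : fn f =1 fn g -> f = g.
Proof. by move=> fg; apply: val_inj; apply: funext. Qed.

Definition bicommutant_mk f (fP : bicommutes f) : K :=
  @sub_space_mk _ _ (Subspace bicommutes_subspace) f fP.

Lemma bicommutes_id : bicommutes id.
Proof. by split. Qed.

Lemma bicommutes_comp (f g : K) : bicommutes (fn f \o fn g).
Proof.
have [[fL fA] fC] := bicommutantP f; have [[gL gA] gC] := bicommutantP g.
split=> [|h hE hd x] /=; last by rewrite gC // fC.
by split=> [a x y|a x] /=; rewrite ?gL ?fL // gA fA.
Qed.

Definition bicommutant_one := bicommutant_mk bicommutes_id.
Definition bicommutant_mul f g := bicommutant_mk (bicommutes_comp f g).

Let mulA : associative bicommutant_mul.
Proof. by move=> f g h; apply: bicommutant_eq. Qed.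
Let mulC : commutative bicommutant_mul.
Proof.
move=> f g; apply: bicommutant_eq => x /=.
have [gE gC] := bicommutantP g; have [_ fC] := bicommutantP f.
(* [g] commutes with [d], since [d] commutes with itself; hence [f] commutes with [g]. *)
by apply: fC => // y; apply: gC.
Qed.
Let mul1 : left_id bicommutant_one bicommutant_mul.
Proof. by move=> f; apply: bicommutant_eq. Qed.
Let mulDl : left_distributive bicommutant_mul +%R.
Proof. by move=> f g h; apply: bicommutant_eq. Qed.
Let one_neq0 : bicommutant_one != 0.
Proof.
apply/eqP => one0; have [[s s0] _] := S_simple; apply: s0.
by have /(congr1 (fun f => fn f s)) := one0.
Qed.

HB.instance Definition _ :=
  GRing.Zmodule_isComNzRing.Build K mulA mulC mul1 mulDl one_neq0.

(** Schur's lemma: kernel and image of a nonzero [f] are submodules of [S], so [f] is bijective, and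
    its inverse inherits the commutations. The first clause is the convention that 0 has inverse
    0. *)
Let inv_exists (f : K) : exists g : K, (f = 0 -> g = 0) /\ (f != 0 -> g * f = 1).
Proof.
have [->|f0] := eqVneq f 0; first by exists 0.
have [[fL fA] fC] := bicommutantP f; have f00 := endo0 (conj fL fA).
have fB x y : fn f (x - y) = fn f x - fn f y.
  by rewrite addrC -scaleN1r fL scaleN1r addrC.
have inj x y : fn f x = fn f y -> x = y.
  move=> fxy; apply/eqP; rewrite -subr_eq0; apply/eqP.
  have [|a z fz|N0|N1] := S_simple.2 (fun x => fn f x = 0).
  - by split=> // a u v fu fv; rewrite fL fu fv scaler0 addr0.
  - by rewrite fA fz (bilin0r Sb).
  - by apply: N0; rewrite fB fxy subrr.
  - by case/eqP: f0; apply: bicommutant_eq => z; rewrite N1.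
have surj y : exists x, fn f x = y.
  have [|a _ [x <-]|N0|//] := S_simple.2 (fun y => exists x, fn f x = y).
  - split=> [|a _ _ [x <-] [z <-]]; first by exists 0.
    by exists (a *: x + z); rewrite fL.
  - by exists (act a x); rewrite fA.
  - by case/eqP: f0; apply: bicommutant_eq => z; rewrite (N0 (fn f z)) //; exists z.
pose g y := sval (cid (surj y)).
have gK y : fn f (g y) = y by rewrite /g; case: cid.
have gP : bicommutes g.
  split=> [|h hE hd x]; last by apply: inj; rewrite gK fC // gK.
  split=> [a x y|a x]; apply: inj; first by rewrite fL !gK.
  by rewrite fA !gK.
exists (bicommutant_mk gP); split=> [fE|_]; first by rewrite fE eqxx in f0.
by apply: bicommutant_eq => x; apply: inj; apply: gK.
Qed.

Let inv f := sval (cid (inv_exists f)).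
Let mulVf f : f != 0 -> inv f * f = 1.
Proof. by rewrite /inv; case: cid => g /= [_ gP] /gP. Qed.
Let inv0 : inv 0 = 0.
Proof. by rewrite /inv; case: cid => g /= [gP _]; apply: gP. Qed.

HB.instance Definition _ := GRing.ComNzRing_isField.Build K mulVf inv0.

Definition bicommutant_scalar (c : F) : K := c *: bicommutant_one.

Let scalarB : zmod_morphism bicommutant_scalar.
Proof. by move=> a b; rewrite /bicommutant_scalar scalerBl. Qed.
Let scalarM : monoid_morphism bicommutant_scalar.
Proof.
split; first exact: scale1r.
move=> a b; apply: bicommutant_eq => x; exact: esym (scalerA _ _ _).
Qed.
HB.instance Definition _ :=
  GRing.isZmodMorphism.Build F K bicommutant_scalar scalarB.
HB.instance Definition _ :=
  GRing.isMonoidMorphism.Build F K bicommutant_scalar scalarM.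

Local Notation iota := (bicommutant_scalar : {rmorphism F -> K}).

(* The evaluation [k (x) s |-> k s] has a proper kernel, which contains
   [d (x) s - 1 (x) d s]; the latter is nonzero unless [d] is a scalar. *)
Lemma ext_simple_scalar : simple_module (ext_alg_module iota S) ->
  exists c, forall x, d x = c *: x.
Proof.
move=> SK_simple; apply: contrapT => nscal.
have [[s s0] _] := S_simple.
pose ev (x : ext_space iota S) : S := tens_lift (fun (k : K) v => fn k v) x.
have evP : balanced iota (fun (k : K) v => fn k v).
  split=> [//|k v w|k c v].
    by have := (bicommutantP k).1.1 1 v w; rewrite !scale1r.
  by [].
have ev0 : ev 0 = 0 := tens_lift0 evP.
have evD x y : ev (x + y) = ev x + ev y := tens_liftD evP x y.
have evT k v : ev (tens iota k v) = fn k v := tens_lift_tens evP k v.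
have evZ (k : K) x : ev (k *: x) = fn k (ev x).
  elim/ext_ind: x => [|l v x IH].
    by rewrite scaler0 ev0 (endo0 (bicommutantP k).1).
  have := (bicommutantP k).1.1 1 (fn l v) (ev x); rewrite !scale1r => E.
  by rewrite scalerDr tens_scale !evD IH !evT E.
have SKb := act_bilin (ext_alg_module iota S).
(* Elements of [K] commute with [A], so the kernel of [ev] is a submodule. *)
have evA k a (x : ext_alg_module iota S) :
    ev (act (tens iota k a : ext_algebra iota A) x) = fn k (act a (ev x)).
  have [[kL kA] kC] := bicommutantP k; have k0 := endo0 (bicommutantP k).1.
  elim/ext_ind: x => [|l v x IH].
    by rewrite (bilin0r SKb) ev0 (bilin0r Sb) k0.
  have E : act (tens iota k a : ext_algebra iota A) (tens iota l v : ext_alg_module iota S) =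
    tens iota (k * l) (act a v) := ext_op_tens iota (act_bilin S) k a l v.
  rewrite (bilinDr SKb) !evD IH E !evT.
  have := kL 1 (act a (fn l v)) (act a (ev x)); rewrite !scale1r (bilinDr Sb) => ->.
  by rewrite -(bicommutantP l).1.2.
have [|a x evx|N0|N1] := SK_simple.2 (fun x => ev x = 0).
- split=> // k x y ex ey; rewrite evD evZ ex ey addr0.
  exact: endo0 (bicommutantP k).1.
- elim/ext_ind: a => [|k a y IH]; first by rewrite (bilin0l SKb).
  rewrite (bilinDl SKb) evD IH evA evx (bilin0r Sb) addr0.
  exact: endo0 (bicommutantP k).1.
- have dP : bicommutes d by split=> // g _ gd x; rewrite gd.
  pose dK := bicommutant_mk dP.
  (* [phi] is 1 at [d] and 0 on the scalars, so contracting [d (x) s = 1 (x) d s] gives [s = 0]. *)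
  have [||phi [phiP phid phi1]] := @separating_functional F (restricted iota)
      (fun x => exists c, x = iota c) (dK : K).
  + split=> [|a _ _ [b ->] [c ->]]; first by exists 0; rewrite rmorph0.
    by exists (a * b + c); rewrite restricted_scaleE rmorphD rmorphM.
  + move=> [c dc]; apply: nscal; exists c => x.
    by have /(congr1 (fun f => fn f x)) := dc.
  apply: s0; have /N0 : ev (tens iota dK s - tens iota 1 (d s)) = 0.
    rewrite -scaleN1r evD evZ !evT; exact: subrr.
  move/eqP; rewrite subr_eq0 => /eqP/(congr1 (contract phi)).
  rewrite !contract_tens // phid scale1r phi1 ?scale0r //.
  by exists 1; rewrite rmorph1.
- by apply: s0; rewrite -[s]/(fn (1 : K) s) -evT N1.
Qed.

End Bicommutant.

(** * Scalar endomorphisms and the equivalence *)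

Lemma absolutely_simple_scalar (F : fieldType) (A : assoc_algebra F) (S : alg_module A) f :
  absolutely_simple S -> alg_endo (S := S) f -> exists c, forall x, f x = c *: x.
(* The extension field chosen here is the bicommutant of [f] itself. *)
Proof. by move=> [S_simple SK] fE; exact: (@ext_simple_scalar _ _ _ _ fE S_simple (SK _ _)). Qed.

Lemma End_voa_top_endo (F : fieldType) (V : voa F) (M : admissible_module V)
    (f : {linear M -> M}) (f_top : forall w, mgr M 0 w -> mgr M 0 (f w)) :
  End_voa f ->
  alg_endo (S := zhu_top M) (fun w => @sub_space_mk _ _ (top_space M) _ (f_top _ (sub_spaceP w))).
Proof.
move=> fE; split=> [a x y|a x]; apply: val_inj; first by rewrite /= linearP.
rewrite -(quot_reprK a); move: (quot_repr a) => u.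
apply: etrans _ (esym (zhu_actE u _)).
rewrite -[LHS]/(f (val (@zhu_act F V M (quot_class (zhu_O V) u) x))) zhu_actE raddf_sum.
by apply: eq_bigr => p _; rewrite /= fE.
Qed.

Theorem theorem7p5 (F : fieldType) (V : voa F) (M : admissible_module V)
    (char_ne2 : 2%N \notin [pchar F])
    (V_sfg : strongly_finitely_generated V)
    (M_irr : irreducible_module M)
    (M0_ne0 : exists w : M, mgr M 0 w /\ w <> 0) :
  (absolutely_irreducible M <-> absolutely_simple (zhu_top M)) /\
  (absolutely_simple (zhu_top M) <->
     is_scalars (@End_voa F V M) /\
     is_scalars (@End_alg F (zhu_algebra V) (zhu_top M))).
Proof.
have top_simple := zhu_top_simple M_irr M0_ne0.
split; split.
- move=> [_ MK_irr]; split=> // K iota.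
  exact: ext_top_simple M0_ne0 (MK_irr K iota).
- move=> [_ SK_simple]; split=> // K iota.
  exact: ext_irreducible M_irr M0_ne0 (SK_simple K iota).
- move=> S_abs; split=> f; split=> [fE|[c fc]].
  (* The restriction of [f] to [M(0)] is a scalar [c], and [M(0)] generates [M]. *)
  + have f_top w : mgr M 0 w -> mgr M 0 (f w) by apply: End_voa_top.
    have [c cP] := absolutely_simple_scalar S_abs (End_voa_top_endo f_top fE).
    exists c; apply: End_voa_scalar => // w w0.
    by have /(congr1 val) := cP (@sub_space_mk _ _ (top_space M) w w0).
  + by move=> u n w; rewrite !fc (bilinZr (wm_bilin (adm_weak M) n)).
  + by apply: (absolutely_simple_scalar S_abs); split=> // a x y; rewrite linearP.
  + by move=> a x; rewrite !fc (bilinZr (act_bilin _)).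
- move=> [_ End_scalars]; split=> // K iota; exact: ext_simple.
Qed.
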